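(* For integers $n\ge1$ put $\widehat q_n=6n-2$, $\widehat r=3$, and let $$\widehat B_n=\sum_{i=0}^{\widehat q_n-1}(-1)^i\frac{V_i(1)}{F(1)^{i/\widehat q_n}},$$ where $V_i$ and $F$ are the polynomials associated with $(r,q)=(3,\widehat q_n)$. Then for every sufficiently large integer $n$ one has $\widehat B_n<0$. Consequently, for every sufficiently large $n$, the polynomial $\mathcal{D}_{3,6n-2}$ has a sign-changing zero in $z\in(0,1)$. More precisely, $$\lim_{n\to\infty}\widehat B_n=\frac{e}{e+1}\,(1-\widehat A)<0,\qquad \widehat A=\frac{e^{1/3}(2\pi)^{2/3}}{3^{1/3}\,\Gamma(1/3)}>1 .$$
   Context: For coprime integers $q\ge2$, $1\le r<q$, let $c_i = ir \bmod q\in\{0,\dots,q-1\}$ for every integer $i$ (so $c_i$ is $q$-periodic in $i$). Empty products equal $1$. Define $$\mathcal{D}_{r,q}(z)=\det\left[\prod_{m=0}^{j-1}(z+c_{i+m})\right]_{0\le i,j\le q-1},$$ $$V_0(z)=1,\qquad V_i(z)=\prod_{m=0}^{i-1}(z+c_m)\quad(1\le i\le q),\qquad F(z)=V_q(z)=\prod_{a=0}^{q-1}(z+a).$$ In particular $F(1)=q!$, and $F(1)^{1/q}$ denotes the positive $q$-th root. A sign-changing zero is a real zero across which the real polynomial $\mathcal{D}_{r,q}$ changes sign. *)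

(* Defs.v *)
(* MathComp / MathComp-Analysis; reals are an arbitrary [R : realType]. *)
From HB Require Import structures.
From mathcomp Require Import all_boot all_order all_algebra.
From mathcomp Require Import all_classical all_reals all_analysis.
Set Implicit Arguments.
Unset Strict Implicit.
Unset Printing Implicit Defensive.
Import Order.TTheory GRing.Theory Num.Theory.
Import numFieldNormedType.Exports.
Local Open Scope classical_set_scope.
Local Open Scope ring_scope.

(* Only nonnegative indices occur below, so i ranges over nat. *)
Definition cres (r q i : nat) : nat := ((i * r) %% q)%N.

Definition Dpoly (R : realType) (r q : nat) : {poly R} :=
  \det (\matrix_(i < q, j < q)
          \prod_(m < j) ('X + ((cres r q (i + m))%:R)%:P) : 'M[{poly R}]_q).

Definition Vpoly (R : realType) (r q i : nat) : {poly R} :=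
  \prod_(m < i) ('X + ((cres r q m)%:R)%:P).

(* For r prime to q this is the product of the 'X + a, 0 <= a < q
   (lemma [Fpoly_prod]). *)
Definition Fpoly (R : realType) (r q : nat) : {poly R} := Vpoly R r q q.

Definition sign_changing_zero (R : realType) (p : {poly R}) (z : R) : Prop :=
  root p z /\
  exists2 e : R, 0 < e &
    forall x y : R, z - e < x < z -> z < y < z + e -> p.[x] * p.[y] < 0.

(* Euler's integral, meaningful for s > 0. *)
Definition Gamma (R : realType) (s : R) : R :=
  \int[@lebesgue_measure R]_(t in `]0, +oo[) (t `^ (s - 1) * expR (- t)).

(* Truncated subtraction: qhat 0 = 0, but only n >= 1 is meaningful. *)
Definition qhat (n : nat) : nat := (6 * n - 2)%N.

(* Since 0 < F(1), the real power [`^] is the i-th power of the positive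
   q-th root of F(1). *)
Definition Bhat (R : realType) (n : nat) : R :=
  \sum_(i < qhat n)
    (-1) ^+ i * ((Vpoly R 3 (qhat n) i).[1] /
                 (Fpoly R 3 (qhat n)).[1] `^ (i%:R / (qhat n)%:R)).

Definition Ahat (R : realType) : R :=
  expR (3^-1) * (2 * pi) `^ (2 / 3) / (3 `^ (3^-1) * Gamma (3^-1)).

Lemma coprime_qhat (n : nat) : (0 < n)%N -> coprime 3 (qhat n) && (3 < qhat n)%N.
Proof.
case: n => // n _.
have -> : qhat n.+1 = ((2 * n + 1) * 3 + 1)%N.
  by rewrite /qhat mulnS mulnDl mul1n mulnAC -addnA -[RHS]addnC addnC -addnBA // addnC.
by rewrite /coprime gcdnMDl gcdn1 eqxx /= !addn1 ltnS leq_pmull.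
Qed.

Lemma Fpoly_prod (R : realType) (r q : nat) : coprime r q ->
  Fpoly R r q = \prod_(a < q) ('X + (a%:R)%:P).
Proof.
case: q => [|q] crq; first by rewrite /Fpoly /Vpoly !big_ord0.
pose h (m : 'I_q.+1) : 'I_q.+1 := inord (cres r q.+1 m).
have hE m : h m = cres r q.+1 m :> nat by rewrite inordK // ltn_mod.
have h_inj : injective h.
  move=> m1 m2 /(congr1 val) /=; rewrite !hE /cres => /eqP H.
  apply/val_inj; rewrite /= -(modn_small (ltn_ord m1)) -(modn_small (ltn_ord m2)).
  wlog le12 : m1 m2 H / (m1 <= m2)%N => [hw|].
    by case/orP: (leq_total m1 m2) => le; [|symmetry]; apply: hw; rewrite // eq_sym.
  apply/esym/eqP; rewrite eqn_mod_dvd //.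
  have := H; rewrite eq_sym eqn_mod_dvd ?leq_mul2r ?le12 ?orbT //.
  by rewrite -mulnBl Gauss_dvdl // coprime_sym.
rewrite [RHS](reindex_inj h_inj) /Fpoly /Vpoly.
by apply: eq_bigr => m _; rewrite hE.
Qed.

Lemma Fpoly1 (R : realType) (r q : nat) : coprime r q ->
  (Fpoly R r q).[1] = (q`!)%:R.
Proof.
move=> /Fpoly_prod ->; rewrite horner_prod fact_prod big_add1 big_mkord natr_prod.
by apply: eq_bigr => a _; rewrite !hornerE -natr1 addrC.
Qed.

(* Main.v *)
(* The matrix [prod_(m < j) (z + c_(i+m))] has entries V_(i+j) / V_i, and
   V_(k+q) = F V_k, so with W_k = V_k / F^(k/q), which is q-periodic, D(z) is a
   positive multiple of the determinant of the Hankel matrix [W_(i+j)]. A discrete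
   Fourier transform turns the latter into a nonzero constant times the product
   of the Fourier coefficients of W. For q even, two of these are
   A = sum W_j > 0 and B = sum (-1)^j W_j, and the others pair off into squared
   moduli. As z tends to 0+, B tends to 1, so B < 0 at z = 1 forces a sign change.

   For r = 3 and q = 3N + 1 the numbers 1 + c_i form the three runs
   1, 4, ..., 3N + 1, then 3, 6, ..., 3N, then 2, 5, ..., 3N - 1. On each run the
   alternating sum of the W_i telescopes up to O(1/g), where g = F(1)^(1/q) ~ 3N/e,
   and only the ends of the runs contribute. There W is 1, then O(N^(-1/3)), then
   tends to Ahat, by Stirling's formula and Gauss' product for Gamma(1/3), and
   finally 1 again; N being odd gives the signs. *)
Require Import Defs.
From HB Require Import structures.
From mathcomp Require Import all_boot all_order all_algebra.
From mathcomp Require Import cyclic separable cyclotomic.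
From mathcomp Require Import all_classical all_reals all_analysis.
From mathcomp Require Import measurable_realfun complex.
From mathcomp Require Import zify ring lra.
Import Order.TTheory GRing.Theory Num.Theory.
Import numFieldNormedType.Exports.
Local Open Scope classical_set_scope.
Local Open Scope ring_scope.
Set Implicit Arguments.
Unset Strict Implicit.
Unset Printing Implicit Defensive.

(** * The Gamma function *)

Section GammaFunction.
Variable R : realType.
Implicit Types s t x a b r : R.
Local Notation mu := (@lebesgue_measure R).

Let euler s t : R := t `^ (s - 1) * expR (- t).
(** Keeping the integral in the extended reals lets the functional equation and the inequalities be
    proved before finiteness is known; [Gamma s] is its [fine] part. *)
Let eGamma s : \bar R := (\int[mu]_(t in `]0%R, +oo[) (euler s t)%:E)%E.

Let euler_ge0 s t : 0 <= euler s t.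
Proof. by rewrite mulr_ge0 ?powR_ge0 ?expR_ge0. Qed.

Let measurable_euler s (D : set R) : measurable_fun D (euler s).
Proof.
apply: measurable_funTS; apply: measurable_funM.
  exact: measurable_powR.
by apply: measurableT_comp => //; exact: continuous_measurable_fun (@continuous_expR R).
Qed.

Lemma is_derive_powR s t : 0 < t -> is_derive t 1 (@powR R ^~ s) (s * t `^ (s - 1)).
Proof.
move=> t0; have ti : t \in `]0, +oo[ by rewrite in_itv/= t0.
apply: DeriveDef; first exact: derivable_powR.
by rewrite -derive1E powR_derive1.
Qed.

Let is_derive_euler s t : 0 < t ->
  is_derive t 1 (fun x => x `^ s * expR (- x)) (s * euler s t - euler (s + 1) t).
Proof.
move=> t0; have ? := is_derive_powR s t0.
apply: is_derive_eq; rewrite /euler addrK /GRing.scale /=; ring.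
Qed.

Let derivable_euler s t : 0 < t -> derivable (euler s) t 1.
Proof.
move=> t0; have ? := is_derive_powR (s - 1) t0.
exact: ex_derive.
Qed.

Let within_euler s a b : 0 < a -> {within `[a, b], continuous (euler s)}.
Proof.
move=> a0; apply: derivable_within_continuous => t; rewrite in_itv/= => /andP[at_ _].
exact/derivable_euler/(lt_le_trans a0).
Qed.

Let integrable_euler s a b : 0 < a -> mu.-integrable `[a, b] (EFin \o euler s).
Proof.
move=> a0; apply: continuous_compact_integrable; first exact: segment_compact.
exact: within_euler.
Qed.

(** Integration by parts on a segment away from 0, where t^s e^(-t) has the continuous derivative
    [s * euler s t - euler (s + 1) t]. *)
Let euler_parts s a b : 0 < a -> a < b ->
  (s%:E * \int[mu]_(t in `[a, b]) (euler s t)%:E =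
   \int[mu]_(t in `[a, b]) (euler (s + 1) t)%:E
   + (b `^ s * expR (- b) - a `^ s * expR (- a))%:E)%E.
Proof.
move=> a0 ab; have b0 := lt_trans a0 ab.
pose F x := x `^ s * expR (- x).
have dF t : 0 < t -> is_derive t 1 F (s * euler s t - euler (s + 1) t).
  exact: is_derive_euler.
have cF t : 0 < t -> {for t, continuous F}.
  move=> t0; apply/differentiable_continuous/derivable1_diffP.
  by have ? := dF _ t0; exact: ex_derive.
have ie r : mu.-integrable `[a, b] (EFin \o euler r) by exact: integrable_euler.
have : (\int[mu]_(t in `[a, b]) (s * euler s t - euler (s + 1) t)%:E
        = (F b)%:E - (F a)%:E)%E.
  apply: continuous_FTC2 => //.
  - apply: derivable_within_continuous => t; rewrite in_itv/= => /andP[at_ _].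
    have t0 := lt_le_trans a0 at_.
    apply: (@derivableB _ _ R^o (fun t => s * euler s t)); last exact: derivable_euler.
    by apply: derivableM; [exact: derivable_cst|exact: derivable_euler].
  - split=> [t|//|//].
    + rewrite in_itv/= => /andP[at_ _].
      by have ? := dF _ (lt_trans a0 at_); exact: ex_derive.
    + exact/cvg_at_right_filter/cF.
    + exact/cvg_at_left_filter/cF.
  - move=> t; rewrite in_itv/= => /andP[at_ _].
    by have ? := dF _ (lt_trans a0 at_); rewrite derive1E derive_val.
under eq_integral do rewrite EFinB.
rewrite integralB_EFin//=; last first.
  exact: (@integrableZl _ _ _ mu `[a, b]%classic (measurable_itv _) s _ (ie s)).
under eq_integral do rewrite EFinM.
rewrite integralZl//; last exact: ie.
move=> H.
rewrite EFinB -/(F b) -/(F a) -H addeC subeK//.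
exact: integrable_fin_num (ie _).
Qed.

Let box (n : nat) : set R := `[n.+1%:R^-1, n.+1%:R]%classic.

Let itv0y_exhaust : \bigcup_n box n = `]0, +oo[%classic.
Proof.
apply/seteqP; split=> [t [n _]|t].
  rewrite /box/= !in_itv/= andbT => /andP[nt _].
  by apply: lt_le_trans nt; rewrite invr_gt0.
rewrite /= in_itv/= andbT => t0; exists (Num.trunc (t + t^-1)) => //.
rewrite /box/= in_itv/=.
have ti0 : 0 < t^-1 by rewrite invr_gt0.
have /andP[_ /ltW le] := truncn_itv (ltW (addr_gt0 t0 ti0)).
apply/andP; split; last by apply: le_trans le; rewrite lerDl ltW.
by rewrite invf_ple ?posrE//; apply: le_trans le; rewrite lerDr ltW.
Qed.

Let cvg_eGamma s :
  (\int[mu]_(t in box n) (euler s t)%:E)%E @[n --> \oo] --> eGamma s.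
Proof.
rewrite /eGamma -itv0y_exhaust; apply: ge0_nondecreasing_set_cvg_integral => //.
- move=> m n mn; apply/subsetPset => t; rewrite /box/= !in_itv/= => /andP[mt tm].
  apply/andP; split; last by apply: le_trans tm _; rewrite ler_nat ltnS.
  by apply: le_trans mt; rewrite lef_pV2 ?posrE// ler_nat ltnS.
- by move=> n; exact: measurable_itv.
- by move=> n; apply/measurable_EFinP; exact: measurable_euler.
- by move=> n t _; rewrite lee_fin.
Qed.

Let cvg_boundary s : 0 < s ->
  (n.+1%:R `^ s * expR (- n.+1%:R) - n.+1%:R^-1 `^ s * expR (- n.+1%:R^-1) : R)
    @[n --> \oo] --> (0 : R).
Proof.
move=> s0.
have h0 : (n.+1%:R^-1 `^ s : R) @[n --> \oo] --> (0 : R).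
  apply: ((cvg_at_rightP (fun x : R => x `^ s) 0 0).1 (powR_cvg0 s0)).
  by split=> [n|]; [rewrite invr_gt0|exact: cvg_harmonic].
(* Raising u <= e^u with u = t / (2s) to the power 2s gives e^(-t) <= C t^(-2s), hence t^s e^(-t) <=
   C t^(-s). *)
pose C : R := (2 * s) `^ (2 * s).
have hC (n : nat) : n.+1%:R `^ s * expR (- n.+1%:R) <= C * n.+1%:R^-1 `^ s :> R.
  set t : R := n.+1%:R.
  have t0 : 0 < t by rewrite /t.
  have u0 : 0 < t / (2 * s) by rewrite divr_gt0// mulr_gt0.
  have s20 : 0 < 2 * s by rewrite mulr_gt0.
  have -> : expR (- t) = ((expR (t / (2 * s))) `^ (2 * s))^-1.
    by rewrite /powR gt_eqF ?expR_gt0// expRK mulrC divfK ?gt_eqF// expRN.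
  have : (t / (2 * s)) `^ (2 * s) <= expR (t / (2 * s)) `^ (2 * s).
    rewrite ge0_ler_powR ?nnegrE ?expR_ge0 ?ltW//.
    by apply: lt_le_trans (expR_ge1Dx _); rewrite ltrDr.
  rewrite -lef_pV2 ?posrE ?powR_gt0 ?expR_gt0// => h.
  apply: le_trans (ler_wpM2l (powR_ge0 _ _) h) _.
  rewrite /C /powR !gt_eqF ?invr_gt0// -expRN -!expRD ler_expR.
  by rewrite lnM ?posrE ?invr_gt0// !lnV ?posrE//; lra.
rewrite -[X in _ --> X]subr0; apply: cvgB.
  apply: (@squeeze_cvgr _ _ _ _ (cst 0) (fun n : nat => C * n.+1%:R^-1 `^ s)).
  - by apply: nearW => n; rewrite hC andbT mulr_ge0 ?powR_ge0 ?expR_ge0.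
  - exact: cvg_cst.
  - by rewrite -[X in _ --> X](mulr0 C); apply: cvgM => //; exact: cvg_cst.
apply: (@squeeze_cvgr _ _ _ _ (cst 0) (fun n : nat => n.+1%:R^-1 `^ s)) => //.
- apply: nearW => n; rewrite mulr_ge0 ?powR_ge0 ?expR_ge0//=.
  by rewrite ler_piMr ?powR_ge0// expR_le1 oppr_le0 invr_ge0.
- exact: cvg_cst.
Qed.

Let eGammaD1 s : 0 < s -> eGamma (s + 1) = (s%:E * eGamma s)%E.
Proof.
move=> s0; apply/esym.
have : (\int[mu]_(t in box n) (euler (s + 1) t)%:E
  + (n.+1%:R `^ s * expR (- n.+1%:R) - n.+1%:R^-1 `^ s * expR (- n.+1%:R^-1))%:E)%E
    @[n --> \oo] --> (eGamma (s + 1) + 0%:E)%E.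
  apply: cvgeD => //; first by rewrite /adde_def/= !andbF.
  by apply: cvg_EFin; [exact: nearW|exact: cvg_boundary].
rewrite adde0 => H.
have L := cvgeZl (isT : s%:E \is a fin_num) (@cvg_eGamma s).
apply: cvg_unique L _ => //; apply: cvg_trans H.
(* For n = 0 the segment [box n] degenerates to [1, 1], and [euler_parts] needs a < b. *)
apply: near_eq_cvg; exists 1%N => // n /= n1.
rewrite euler_parts// ?invr_gt0//.
rewrite (@lt_trans _ _ 1)// ?invf_lt1 ?ltr1n//.
Qed.

Let eGamma1 : eGamma 1 = 1%E.
Proof.
rewrite /eGamma integral_itv_obnd_cbnd; last first.
  by apply/measurable_EFinP; exact: measurable_euler.
under eq_integral => t _ do rewrite /euler subrr powRr0 mul1r.
have dF x : is_derive x 1 (fun x : R => - expR (- x)) (expR (- x)).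
  by apply: is_derive_eq; rewrite /GRing.scale /=; ring.
have cE : continuous (fun x : R => expR (- x)).
  move=> x; apply: continuous_comp; last exact: continuous_expR.
  exact: (@continuousN _ R^o).
rewrite (@ge0_continuous_FTC2y _ _ (fun x => - expR (- x)) _ 0)//.
- by rewrite oppr0 expR0 EFinN oppeK add0e.
- exact: continuous_subspaceT.
- by rewrite -oppr0; apply: cvgN; exact: cvgr_expR.
- by apply: cvgN; apply/cvg_at_right_filter; exact: cE.
- by move=> x _; rewrite derive1E derive_val.
Qed.

Let eGamma_ge0 s : (0 <= eGamma s)%E.
Proof. by apply: integral_ge0 => t _; rewrite lee_fin. Qed.

Let measurable_eulerE s (D : set R) : measurable_fun D (fun t => (euler s t)%:E).
Proof. by apply/measurable_EFinP; exact: measurable_euler. Qed.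

(** Transfers a pointwise bound on integrands to the integrals; it serves both finiteness and
    log-convexity. *)
Let eGamma_le2 a b c (k l : R) : 0 <= k -> 0 <= l ->
  (forall t, 0 < t -> euler a t <= k * euler b t + l * euler c t) ->
  (eGamma a <= k%:E * eGamma b + l%:E * eGamma c)%E.
Proof.
move=> k0 l0 h.
have e0 r t : (0 <= (euler r t)%:E)%E by rewrite lee_fin.
have me r := @measurable_eulerE r.
rewrite /eGamma -!ge0_integralZl_EFin//=; [|exact: me..].
have z0 r (d : R) t : 0 <= d -> (0 <= d%:E * (euler r t)%:E)%E.
  by move=> d0; rewrite mule_ge0// lee_fin.
have mz r (d : R) (D : set R) : measurable_fun D (fun t => d%:E * (euler r t)%:E)%E.
  by apply: emeasurable_funM; [exact: measurable_cst|exact: me].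
rewrite -ge0_integralD//=; last first.
- exact: mz.
- by move=> t _; exact: z0.
- exact: mz.
- by move=> t _; exact: z0.
apply: ge0_le_integral => //=.
- by apply: me.
- by apply: emeasurable_funD; exact: mz.
move=> t; rewrite /= in_itv/= andbT => t0.
by rewrite -!EFinM -EFinD lee_fin h.
Qed.

Let eulerD s u t : 0 < t -> euler (s + u) t = t `^ u * euler s t.
Proof.
move=> t0; rewrite /euler mulrA -powRD; last by apply/implyP => _; rewrite gt_eqF.
by congr (_ `^ _ * _); ring.
Qed.

(** Since t^s <= 1 + t, the integral at s + 1 is at most the sum of those at 1 and 2, which are
    finite; an infinite value at s would make the value at s + 1 infinite too. *)
Let eGamma_fin01 s : 0 < s <= 1 -> eGamma s \is a fin_num.
Proof.
move=> /andP[s0 s1].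
have h : (eGamma (s + 1) <= 1%:E * eGamma 1 + 1%:E * eGamma (1 + 1))%E.
  apply: eGamma_le2 => // t t0.
  rewrite [s + 1]addrC !eulerD// (powRr1 (ltW t0)) !mul1r -{2}[euler 1 t]mul1r -mulrDl.
  rewrite ler_wpM2r//.
  have [t1|/ltW t1] := leP t 1.
    apply: (@le_trans _ _ 1); last by rewrite lerDl ltW.
    have := @ge0_ler_powR R s (ltW s0) t 1.
    by rewrite powR1 /= !nnegrE; apply => //; exact: ltW.
  apply: (@le_trans _ _ t); last by rewrite lerDr.
  by have := ler_powR t1 s1; rewrite (powRr1 (ltW t0)).
rewrite ge0_fin_numE// ltNge leye_eq; apply/negP => /eqP E.
by move: h; rewrite !eGammaD1// E eGamma1 gt0_muley// !mul1e.
Qed.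

Let eGamma_fin s : 0 < s -> eGamma s \is a fin_num.
Proof.
move=> s0; have [n] : exists n, s <= n%:R :> R.
  by exists (Num.trunc s).+1; rewrite ltW// truncnS_gt.
elim: n s s0 => [|n IH] s s0; first by rewrite leNgt s0.
have [s1 _|s1 sn] := leP s 1; first by rewrite eGamma_fin01// s0.
rewrite -[s](subrK 1) eGammaD1 ?subr_gt0// fin_numM// IH ?subr_gt0//.
by rewrite lerBlDr natr1.
Qed.

Let Gamma_eGamma s : Gamma s = fine (eGamma s).
Proof. by []. Qed.

Lemma Gamma1 : Gamma 1 = 1 :> R.
Proof. by rewrite Gamma_eGamma eGamma1. Qed.

Lemma GammaD1 s : 0 < s -> Gamma (s + 1) = s * Gamma s.
Proof. by move=> s0; rewrite !Gamma_eGamma eGammaD1// fineM// eGamma_fin. Qed.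

Lemma GammaS n : Gamma n.+1%:R = n`!%:R :> R.
Proof.
elim: n => [|n IH]; first exact: Gamma1.
by rewrite -natr1 GammaD1// IH -natrM factS.
Qed.

Lemma GammaD_prod s n : 0 < s ->
  Gamma (n.+1%:R + s) = (\prod_(k < n.+1) (k%:R + s)) * Gamma s.
Proof.
move=> s0; elim: n => [|n IH].
  by rewrite big_ord_recr big_ord0 /= mul1r add0r addrC GammaD1.
rewrite big_ord_recr/= [\prod_(i < n.+1) _ * _]mulrC -mulrA -IH -natr1 addrAC GammaD1//.
by rewrite addr_gt0.
Qed.

(** Young's inequality for (t / l)^s and 1 with conjugate exponents 1/s and 1/(1 - s); the scale l
    stays free so that it can be optimized after integration. *)
Let young s l t : 0 < s < 1 -> 0 < l -> 0 < t ->
  t `^ s <= l `^ s * (1 - s) + l `^ s * s / l * t.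
Proof.
move=> /andP[s0 s1] l0 t0.
have u0 : 0 <= t / l by rewrite divr_ge0 ?ltW.
have -> : t `^ s = l `^ s * (t / l) `^ s.
  by rewrite -powRM// 1?mulrC ?divfK ?gt_eqF ?ltW.
rewrite -!mulrA -mulrDr ler_wpM2l ?powR_ge0//.
have := @conjugate_powR R ((t / l) `^ s) 1 s^-1 (1 - s)^-1.
rewrite mulr1 -powRrM mulfV ?gt_eqF// powRr1// powR1 /= !invrK mul1r => h.
apply: le_trans (h (powR_ge0 _ _) ler01 _ _ _) _; rewrite ?invr_gt0 ?subr_gt0//.
  by rewrite addrC subrK.
by rewrite le_eqVlt; apply/orP; left; apply/eqP; ring.
Qed.

(** A linearized form of the log-convexity of Gamma. The choice l = x, where Gamma(x + 1) = x
    Gamma(x), yields Gamma(x + s) <= x^s Gamma(x). *)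
Lemma Gamma_interp x s l : 0 < x -> 0 < s < 1 -> 0 < l ->
  Gamma (x + s) <= l `^ s * (1 - s) * Gamma x + l `^ s * s / l * Gamma (x + 1).
Proof.
move=> x0 /[dup] s01 /andP[s0 s1] l0; rewrite !Gamma_eGamma.
have f1 := eGamma_fin x0; have f2 := eGamma_fin (addr_gt0 x0 ltr01).
rewrite -lee_fin EFinD !EFinM !fineK ?eGamma_fin ?addr_gt0// -!EFinM.
apply: eGamma_le2.
- by rewrite mulr_ge0 ?powR_ge0 ?subr_ge0 ?ltW.
- by rewrite !mulr_ge0 ?powR_ge0 ?invr_ge0 ?ltW.
move=> t t0; rewrite !eulerD// (powRr1 (ltW t0)) mulrA -mulrDl ler_wpM2r//.
exact: young.
Qed.

(** Gauss' approximants of Gamma(s), with (n + 1)^s in place of the usual n^s, so that the index n =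
    0 already gives a useful bound. *)
Definition gauss_seq s n : R := n`!%:R * n.+1%:R `^ s / \prod_(k < n.+1) (k%:R + s).

(** Interpolation between n + 1 and n + 2 bounds Gamma(n + 1 + s) by (n + 1)^s n!; the functional
    equation brings this down to s. *)
Lemma Gamma_le_gauss s n : 0 < s < 1 -> Gamma s <= gauss_seq s n.
Proof.
move=> /[dup] s01 /andP[s0 s1].
have P0 : 0 < \prod_(k < n.+1) (k%:R + s) by apply: prodr_gt0 => k _; rewrite ltr_wpDl.
rewrite /gauss_seq ler_pdivlMr// mulrC -GammaD_prod//.
have := @Gamma_interp n.+1%:R s n.+1%:R (ltr0Sn _ _) s01 (ltr0Sn _ _).
rewrite (GammaD1 (ltr0Sn _ _)) !mulrA divfK ?pnatr_eq0// GammaS => h.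
by apply: le_trans h _; rewrite le_eqVlt; apply/orP; left; apply/eqP; ring.
Qed.

(** Interpolation from x = n + 1 + s by the step 1 - s gives (n + 1)! = Gamma(n + 2) <= x^(1 - s)
    Gamma(x), and the factor on the right is x / (n + 1). *)
Lemma gauss_le_Gamma s n : 0 < s < 1 -> gauss_seq s n <= (1 + s / n.+1%:R) * Gamma s.
Proof.
move=> /andP[s0 s1].
have P0 : 0 < \prod_(k < n.+1) (k%:R + s) by apply: prodr_gt0 => k _; rewrite ltr_wpDl.
set x : R := n.+1%:R + s.
have x0 : 0 < x by rewrite /x ltr_wpDl.
have := @Gamma_interp x (1 - s) x x0 _ x0.
rewrite subr_gt0 s1 gtrBl s0 => /(_ isT).
rewrite (GammaD1 x0) !mulrA divfK ?gt_eqF//.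
rewrite (_ : _ + _ = x `^ (1 - s) * Gamma x); last by ring.
have -> : x + (1 - s) = n.+2%:R by rewrite /x -[in RHS]natr1; ring.
rewrite GammaS /x GammaD_prod// -/x => h.
rewrite /gauss_seq ler_pdivrMr//.
have xE : x = x `^ s * x `^ (1 - s).
  rewrite -powRD; last by apply/implyP => _; rewrite gt_eqF.
  by rewrite addrC subrK powRr1 ?ltW.
have -> : 1 + s / n.+1%:R = x / n.+1%:R by rewrite /x mulrDl divff// pnatr_eq0.
rewrite -!mulrA mulrCA ler_pdivlMl// {1}xE -mulrA.
have -> : n.+1%:R * (n`!%:R * n.+1%:R `^ s) = n.+1%:R `^ s * n.+1`!%:R.
  by rewrite factS natrM; ring.
apply: ler_pM => //; rewrite ?powR_ge0//.
  apply: ge0_ler_powR; rewrite ?nnegrE ?ler0n ?(ltW s0) ?(ltW x0)//.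
  by rewrite /x lerDl ltW.
by rewrite [Gamma s * _]mulrC.
Qed.
End GammaFunction.

(** * Wallis' product and Stirling's formula *)

Section WallisStirling.
Variable R : realType.
Implicit Types (x y a b : R) (n k : nat).

Lemma is_derive_ge0_le (f df : R -> R) a b : a <= b ->
  (forall x, a <= x <= b -> is_derive x 1 f (df x)) ->
  (forall x, a <= x <= b -> 0 <= df x) -> f a <= f b.
Proof.
move=> ab Df df0.
apply: (@ger0_derive1_ndecr R f a b) => // [x|x|].
- rewrite in_itv/= => /andP[/ltW ax /ltW xb].
  by have ? := Df x; apply: ex_derive; apply: Df; rewrite ax.
- rewrite in_itv/= => /andP[/ltW ax /ltW xb].
  have := Df x; rewrite ax xb => /(_ isT) D.
  by rewrite derive1E derive_val df0 ?ax.
- apply: derivable_within_continuous => x; rewrite in_itv/= => xab.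
  exact: @ex_derive _ _ _ _ _ _ _ (Df x xab).
Qed.

(** Encodes the statement that the integral of sin^n over [0, pi/2] is w, through a primitive and
    without integration theory. *)
Let sin_primitive n (w : R) := exists F : R -> R,
  [/\ forall x, is_derive x 1 F (sin x ^+ n), F 0 = 0 & F (pi / 2) = w].

Let sin_primitive0 : sin_primitive 0 (pi / 2).
Proof. by exists id; split=> // x; rewrite expr0; exact: is_derive_id. Qed.

Let sin_primitive1 : sin_primitive 1 1.
Proof.
exists (fun x => 1 - cos x); split=> [x||].
- by apply: is_derive_eq; rewrite expr1; ring.
- by rewrite cos0 subrr.
- by rewrite cos_pihalf subr0.
Qed.

(** The reduction formula for powers of the sine, with the boundary term kept inside the
    primitive. *)
Let sin_primitiveSS n w : sin_primitive n w ->
  sin_primitive n.+2 (n.+1%:R / n.+2%:R * w).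
Proof.
move=> [F [DF F0 Fp]].
exists (fun x => n.+2%:R^-1 * (n.+1%:R * F x - cos x * sin x ^+ n.+1)); split=> [x||].
- have ? := DF x.
  have ? : is_derive x 1 (fun x => sin x ^+ n.+1) (n.+1%:R * sin x ^+ n * cos x).
    have -> : (fun x => sin x ^+ n.+1) = (sin : R -> R) ^+ n.+1.
      by apply/funext => y; rewrite exprfctE.
    by apply: is_derive_eq; rewrite /GRing.scale.
  apply: is_derive_eq; rewrite /GRing.scale /=.
  have n2 : n.+2%:R != 0 :> R by rewrite pnatr_eq0.
  apply: (mulfI n2); rewrite mulrA mulfV// mul1r.
  have c2 : cos x ^+ 2 = 1 - sin x ^+ 2 by rewrite -(cos2Dsin2 x) addrK.
  rewrite -[n.+2%:R]natr1 !exprS.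
  transitivity (n.+1%:R * sin x ^+ n - n.+1%:R * sin x ^+ n * cos x ^+ 2
    + sin x * (sin x * sin x ^+ n)); first by ring.
  by rewrite c2; ring.
- by rewrite F0 sin0 expr0n /= !mulr0 subr0 mulr0.
- by rewrite Fp cos_pihalf mul0r subr0 mulrA [_ / _]mulrC.
Qed.

Let sin_primitive_mono n w w' : sin_primitive n w -> sin_primitive n.+1 w' -> w' <= w.
Proof.
move=> [F [DF F0 <-]] [G [DG G0 <-]]; rewrite -subr_ge0.
have -> : 0 = F 0 - G 0 by rewrite F0 G0 subrr.
have p0 : 0 <= pi / 2 :> R by rewrite divr_ge0 ?pi_ge0.
apply: (@is_derive_ge0_le (fun x => F x - G x) (fun x => sin x ^+ n - sin x ^+ n.+1)) => // x.
move=> /andP[x0 xp]; have s0 : 0 <= sin x.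
  by apply: sin_ge0_pi; rewrite x0 (le_trans xp)// ler_pdivrMr// ler_peMr ?pi_ge0// ler1n.
by rewrite subr_ge0 exprS ler_piMl ?exprn_ge0// sin_le1.
Qed.

(* [cbin n] is (2n choose n) / 4^n. *)
Fixpoint cbin n : R := if n is m.+1 then (2 * m + 1)%:R / (2 * m + 2)%:R * cbin m else 1.

Let cbin_gt0 n : 0 < cbin n.
Proof. by elim: n => //= n IH; rewrite mulr_gt0// divr_gt0// ltr0n ?addn1 ?addn2. Qed.

Let sin_primitive_even n : sin_primitive (2 * n) (cbin n * (pi / 2)).
Proof.
elim: n => [|n IH]; first by rewrite /= mul1r; exact: sin_primitive0.
by rewrite mulnS add2n /= -(mulrA _ (cbin n)) addn1 addn2; exact: sin_primitiveSS.
Qed.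

Let sin_primitive_odd n : sin_primitive (2 * n).+1 ((2 * n).+1%:R * cbin n)^-1.
Proof.
elim: n => [|n IH]; first by rewrite /= mulr1 invr1; exact: sin_primitive1.
have -> : ((2 * n.+1).+1%:R * cbin n.+1)^-1 =
    (2 * n).+2%:R / (2 * n).+3%:R * ((2 * n).+1%:R * cbin n)^-1 :> R.
  by rewrite mulnS add2n /= addn1 addn2 !invfM invrK; ring.
by rewrite mulnS add2n; exact: sin_primitiveSS.
Qed.

(** Wallis' partial product of the factors (2k)^2 / ((2k - 1)(2k + 1)) for 1 <= k <= n. The
    exponents 2n, 2n + 1 and 2n + 2 of the sine squeeze it against pi / 2. *)
Definition wallis_seq n : R := ((2 * n).+1%:R * cbin n ^+ 2)^-1.

Lemma wallis_le_pi n : wallis_seq n <= pi / 2.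
Proof.
have := sin_primitive_mono (sin_primitive_even n) (sin_primitive_odd n).
rewrite -ler_pdivrMl// /wallis_seq -invfM mulrCA -expr2; exact.
Qed.

Lemma wallis_ge_pi n : (2 * n).+1%:R / (2 * n).+2%:R * (pi / 2) <= wallis_seq n.
Proof.
have := sin_primitive_even n.+1; rewrite mulnS => /(sin_primitive_mono (sin_primitive_odd n)).
rewrite /= addn1 addn2 /wallis_seq.
have := cbin_gt0 n => c0 h.
have -> : ((2 * n).+1%:R * cbin n ^+ 2)^-1 = ((2 * n).+1%:R * cbin n)^-1 / cbin n.
  by rewrite -invfM expr2 mulrA.
by rewrite ler_pdivlMr// mulrAC.
Qed.

(** Two factors of Wallis' product give a bound sharp enough for [Ahat_gt1]. *)
Lemma pi_ge_128_45 : 128 / 45 <= pi :> R.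
Proof.
have E : wallis_seq 2 = 64 / 45 by rewrite /wallis_seq /=; field.
by have := wallis_le_pi 2; rewrite E; lra.
Qed.

Lemma wallis_cvg : wallis_seq n @[n --> \oo] --> (pi / 2 : R).
Proof.
apply: (@squeeze_cvgr _ _ _ _ (fun n => (1 - harmonic n) * (pi / 2)) (cst (pi / 2))).
- apply: nearW => n /=; rewrite wallis_le_pi andbT.
  apply: le_trans (wallis_ge_pi n); rewrite ler_wpM2r ?divr_ge0 ?pi_ge0//.
  have -> : (2 * n).+2%:R = 2 * n.+1%:R :> R by rewrite -natrM mulnS.
  have -> : (2 * n).+1%:R = 2 * n.+1%:R - 1 :> R.
    by rewrite -natrM mulnS add2n -[in RHS]natr1 addrK.
  rewrite /harmonic ler_pdivlMr ?mulr_gt0//.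
  have : n.+1%:R^-1 * n.+1%:R = 1 :> R by rewrite mulVf// pnatr_eq0.
  by move: (n.+1%:R) (n.+1%:R^-1) => m h; nra.
- have E : pi / 2 = (1 - 0) * (pi / 2) :> R by rewrite subr0 mul1r.
  rewrite [X in _ --> X]E.
  apply: cvgM; last exact: cvg_cst.
  by apply: cvgB; [exact: cvg_cst|exact: cvg_harmonic].
- exact: cvg_cst.
Qed.

(** Both sides agree at 1 and the difference has a square as numerator of its derivative. At y = (n
    + 1) / n this makes [stirling_seq] nonincreasing. *)
Lemma ln_ge_rat y : 1 <= y -> 2 * (y - 1) / (y + 1) <= ln y.
Proof.
move=> y1; rewrite -subr_ge0.
have -> : 0 = ln 1 - 2 * (1 - 1) / (1 + 1) :> R by rewrite ln1; field.
apply: (@is_derive_ge0_le (fun y => ln y - 2 * (y - 1) / (y + 1))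
  (fun y => (y - 1) ^+ 2 / (y * (y + 1) ^+ 2))) => // x /andP[x1 _].
  have x0 : 0 < x by apply: lt_le_trans x1.
  have x10 : x + 1 != 0 by rewrite gt_eqF// addr_gt0.
  have ? := is_derive1_ln x0.
  apply: is_derive_eq; rewrite /GRing.scale /=; field.
  by rewrite x10 gt_eqF.
by rewrite divr_ge0 ?sqr_ge0// mulr_ge0 ?sqr_ge0// (le_trans _ x1).
Qed.

(** At y = (n + 1) / n this bounds the decrements of [stirling_seq] by a telescoping series, so that
    the sequence is bounded below. *)
Lemma ln_le_rat y : 1 <= y -> ln y <= (y - y^-1) / 2.
Proof.
move=> y1; rewrite -subr_ge0.
have -> : 0 = (1 - 1^-1) / 2 - ln 1 :> R by rewrite ln1 invr1; field.
apply: (@is_derive_ge0_le (fun y => (y - y^-1) / 2 - ln y)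
  (fun y => (1 - y^-1) ^+ 2 / 2)) => // x /andP[x1 _].
  have x0 : 0 < x by apply: lt_le_trans x1.
  have xn0 : x != 0 by rewrite gt_eqF.
  have ? := is_derive1_ln x0.
  have ? : is_derive x 1 (fun y : R => y^-1) (- x ^- 2 *: (1 : R)).
    exact: (@is_deriveV _ id).
  apply: is_derive_eq; rewrite /GRing.scale /=; field.
  by rewrite gt_eqF.
by rewrite divr_ge0 ?sqr_ge0.
Qed.

(** The logarithm of n! / (n^(n + 1/2) e^(-n)) for n >= 1. *)
Definition stirling_seq n : R := ln n`!%:R - (n%:R + 2^-1) * ln n%:R + n%:R.

Let stirling_seq_step n : (0 < n)%N ->
  0 <= stirling_seq n - stirling_seq n.+1 <= 4^-1 * (n%:R^-1 - n.+1%:R^-1).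
Proof.
move=> n0; rewrite /stirling_seq factS natrM -[n.+1%:R]natr1.
have : 0 < n`!%:R :> R by rewrite ltr0n fact_gt0.
have : 0 < n%:R :> R by rewrite ltr0n.
move: (n%:R) (n`!%:R) => x f x0 f0.
have x10 : 0 < x + 1 by rewrite addr_gt0.
have y1 : 1 <= (x + 1) / x by rewrite ler_pdivlMr// mul1r lerDl.
have := ln_ge_rat y1; have := ln_le_rat y1.
rewrite [ln (_ * f)]lnM ?posrE// ln_div ?posrE// => hu hl.
have -> : ln f - (x + 2^-1) * ln x + x -
    (ln (x + 1) + ln f - (x + 1 + 2^-1) * ln (x + 1) + (x + 1)) =
    (x + 2^-1) * (ln (x + 1) - ln x) - 1 by ring.
have h0 : 0 < x + 2^-1 by rewrite addr_gt0.
move: (ln (x + 1) - ln x) hu hl => d hu hl.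
apply/andP; split.
  have := ler_wpM2l (ltW h0) hl.
  rewrite (_ : _ * (_ / _) = 1) ?subr_ge0//; field.
  by rewrite !gt_eqF// addr_gt0// addr_gt0.
have := ler_wpM2l (ltW h0) hu.
rewrite -(lerD2r (-1)) => /le_trans; apply.
rewrite le_eqVlt; apply/orP; left; apply/eqP; field.
by rewrite !gt_eqF.
Qed.

Let stirling_seq_cvgn : cvgn (fun n => stirling_seq n.+1).
Proof.
apply: nonincreasing_is_cvgn.
  by apply/nonincreasing_seqP => n; have /andP[+ _] := @stirling_seq_step n.+1 isT; rewrite subr_ge0.
exists (stirling_seq 1 - 4^-1) => _ [n _ <-].
suff : stirling_seq 1 - 4^-1 <= stirling_seq n.+1 - 4^-1 * n.+1%:R^-1.
  by move=> /le_trans; apply; rewrite gerBl mulr_ge0.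
elim: n => [|n IH]; first by rewrite invr1 mulr1.
have /andP[_ h] := @stirling_seq_step n.+1 isT.
apply: le_trans IH _; move: h.
move: (stirling_seq n.+1) (stirling_seq n.+2) (n.+1%:R^-1) (n.+2%:R^-1) => a b c d; lra.
Qed.

Let cbin_fact n : cbin n * (4 ^+ n * n`!%:R ^+ 2) = (2 * n)`!%:R.
Proof.
elim: n => [|n IH]; first by rewrite muln0 fact0 expr1n !mulr1.
rewrite mulnS add2n !factS !natrM -IH /= addn1 addn2 exprS.
have -> : (2 * n).+2%:R = 2 * n.+1%:R :> R by rewrite -natrM mulnS.
by field; rewrite -?natr1; rewrite gt_eqF// ltr_wpDl.
Qed.

(** In this combination the factorials reduce to the central binomial coefficient, hence to Wallis'
    product. If l is the limit of [stirling_seq], it gives e^(2l) = 4 (pi / 2). *)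
Let stirling_wallis n : (0 < n)%N ->
  expR (4 * stirling_seq n - 2 * stirling_seq (2 * n)) =
  (4 + 2 * n%:R^-1) * wallis_seq n.
Proof.
move=> n0; have c0 := cbin_gt0 n.
have n0' : 0 < n%:R :> R by rewrite ltr0n.
have f0 m : 0 < m`!%:R :> R by rewrite ltr0n fact_gt0.
have E : ln (2 * n)`!%:R = ln (cbin n) + (2 * n)%:R * ln 2 + 2 * ln n`!%:R.
  have -> : (2 * n)%:R * ln 2 = ln (4 ^+ n) :> R.
    have -> : 4 = 2 ^+ 2 :> R by rewrite -natrX.
    by rewrite -exprM lnXn// mulr_natl.
  rewrite -cbin_fact mulrA lnM ?posrE ?mulr_gt0 ?exprn_gt0//.
  by rewrite lnM ?posrE ?exprn_gt0// [ln (_ ^+ 2)]lnXn// [2 * _]mulr_natl.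
have -> : (4 + 2 * n%:R^-1) * wallis_seq n = 2 / (n%:R * cbin n ^+ 2).
  rewrite /wallis_seq -[(2 * n).+1%:R]natr1 natrM; field.
  by rewrite !gt_eqF// addr_gt0// mulr_gt0.
rewrite -[RHS]lnK ?posrE ?divr_gt0 ?mulr_gt0 ?exprn_gt0//; congr expR.
rewrite ln_div ?posrE ?mulr_gt0 ?exprn_gt0// lnM ?posrE ?exprn_gt0// lnXn//.
rewrite /stirling_seq E natrM lnM ?posrE//.
rewrite -[ln (cbin n) *+ 2]mulr_natl; by field.
Qed.

Lemma cvg_oo_ge_id (phi : nat -> nat) :
  (forall n, (n <= phi n)%N) -> phi n @[n --> \oo] --> \oo.
Proof. by move=> h; apply/cvgnyPge => A; exists A => // n /= An; exact: leq_trans (h n). Qed.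

Lemma stirling_cvg : stirling_seq n @[n --> \oo] --> (ln (2 * pi) / 2 : R).
Proof.
set l := limn (fun n => stirling_seq n.+1).
have cl : stirling_seq n @[n --> \oo] --> l by rewrite -cvg_shiftS.
suff -> : ln (2 * pi) / 2 = l by [].
have c2 : stirling_seq (2 * n)%N @[n --> \oo] --> l.
  apply: (cvg_comp (fun n => 2 * n)%N stirling_seq _ cl).
  by apply: cvg_oo_ge_id => n; rewrite leq_pmull.
have c3 : expR (4 * stirling_seq n - 2 * stirling_seq (2 * n)) @[n --> \oo] --> expR (2 * l).
  have -> : 2 * l = 4 * l - 2 * l by ring.
  apply: continuous_cvg; first exact: continuous_expR.
  by apply: cvgB; apply: cvgM => //; exact: cvg_cst.
have c4 : expR (4 * stirling_seq n - 2 * stirling_seq (2 * n)) @[n --> \oo] --> (2 * pi : R).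
  have -> : 2 * pi = (4 + 2 * 0) * (pi / 2) :> R by rewrite mulr0 addr0; field.
  have : ((4 + 2 * harmonic n) * wallis_seq n.+1) @[n --> \oo] --> ((4 + 2 * 0) * (pi / 2) : R).
    apply: cvgM; last by rewrite cvg_shiftS; exact: wallis_cvg.
    by apply: cvgD; [exact: cvg_cst|apply: cvgM; [exact: cvg_cst|exact: cvg_harmonic]].
  under eq_cvg do rewrite -stirling_wallis//.
  by rewrite (cvg_shiftS (fun n => expR (4 * stirling_seq n - 2 * stirling_seq (2 * n)))).
have := cvg_unique _ c3 c4 => /(_ (@norm_hausdorff _ _)) <-.
by rewrite expRK mulrC mulKf.
Qed.
End WallisStirling.

(** * Alternating sums of products of arithmetic progressions *)

Section AlternatingSums.
Variable R : realFieldType.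
Implicit Types (e : nat -> R) (n k L : nat) (d g x : R).

Lemma alternating_ndecr e n : (forall k, 0 <= e k) ->
  (forall k, e k <= e k.+1) -> `|\sum_(k < n.+1) (-1) ^+ k * e k| <= e n.
Proof.
move=> e0 eS; suff : 0 <= (-1) ^+ n * \sum_(k < n.+1) (-1) ^+ k * e k <= e n.
  move=> /andP[h0 h1]; by rewrite -(normrMsign n) ger0_norm.
elim: n => [|n /andP[h0 h1]]; first by rewrite big_ord_recr big_ord0/= expr0 add0r !mul1r e0 lexx.
rewrite big_ord_recr /= mulrDr [X in _ + X]mulrA -expr2 sqrr_sign mul1r exprS.
rewrite mulN1r mulNr.
by have := eS n => h2; apply/andP; split; lra.
Qed.

(** The second hypothesis says that once the sequence rises it keeps rising. The descending part is
    controlled by its first term, the ascending part by its last. *)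
Lemma alternating_unimodal e n : (forall k, 0 <= e k) ->
  (forall k, e k <= e k.+1 -> e k.+1 <= e k.+2) ->
  `|\sum_(k < n.+1) (-1) ^+ k * e k| <= e 0%N + e n.
Proof.
move=> e0 eU.
(* These asymmetric bounds survive the induction: while e 1 <= e 0, the sum is e 0 minus the sum of
   the shifted sequence. *)
suff : - e n <= \sum_(k < n.+1) (-1) ^+ k * e k <= e 0%N + e n.
  move=> /andP[h0 h1]; rewrite ler_norml h1 andbT; apply: le_trans h0.
  by rewrite lerN2 lerDr.
elim: n e e0 eU => [|n IH] e e0 eU.
  rewrite big_ord_recr big_ord0/= expr0 add0r mul1r lerDl e0 andbT.
  by have := e0 0%N; lra.
have [h|/ltW h] := leP (e 0%N) (e 1%N).
  have eS k : e k <= e k.+1 by elim: k => [|k /eU].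
  have := alternating_ndecr n.+1 e0 eS; rewrite ler_norml => /andP[h1 h2].
  by rewrite h1/=; apply: le_trans h2 _; rewrite lerDr.
have := IH (fun k => e k.+1) (fun k => e0 _) (fun k => eU _).
rewrite [in X in _ -> X]big_ord_recl /= expr0 mul1r => /andP[h1 h2].
have -> : \sum_(i < n.+1) (-1) ^+ bump 0 i * e (bump 0 i) =
    - \sum_(k < n.+1) (-1) ^+ k * e k.+1.
  by rewrite -sumrN; apply: eq_bigr => i _; rewrite /bump /= add1n exprS mulN1r mulNr.
by have := e0 n.+1 => h3; apply/andP; split; lra.
Qed.

Definition arith_prod d g x n : R := \prod_(k < n) ((x + d * k%:R) / g).

Lemma arith_prodS d g x n :
  arith_prod d g x n.+1 = arith_prod d g x n * ((x + d * n%:R) / g).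
Proof. by rewrite /arith_prod big_ord_recr. Qed.

Lemma arith_prod_gt0 d g x n : 0 <= d -> 0 < g -> 0 < x -> 0 < arith_prod d g x n.
Proof.
move=> d0 g0 x0; apply: prodr_gt0 => k _.
by rewrite divr_gt0// ltr_wpDr// mulr_ge0.
Qed.

(* With the weight [phi k = g / (g + x + d k)], the telescoping sums
   [arith_prod k * phi k + arith_prod k.+1 * phi k.+1] agree with [arith_prod k]
   up to the unimodal term [arith_prod k.+1 * (phi k - phi k.+1) = O(1 / g)]. *)
Lemma alternating_arith_prod d g x L : 0 < d -> 0 < g -> 0 < x ->
  `|\sum_(k < L.+1) (-1) ^+ k * arith_prod d g x k
    - (g / (g + x) - (-1) ^+ L.+1 * arith_prod d g x L.+1 * (g / (g + (x + d * L.+1%:R))))|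
  <= d / g * (x / g + arith_prod d g x L.+1).
Proof.
move=> d0 g0 x0.
pose X k := x + d * k%:R.
have X0 k : 0 < X k by rewrite ltr_wpDr// mulr_ge0 ?ler0n// ltW.
have XS k : X k.+1 = X k + d by rewrite /X -natr1; ring.
have gX k : 0 < g + X k by rewrite addr_gt0.
have gX0 k : g + X k != 0 by rewrite gt_eqF.
have gn0 : g != 0 by rewrite gt_eqF.
pose P := arith_prod d g x; pose phi k := g / (g + X k).
have P0 k : 0 < P k by apply: arith_prod_gt0 => //; exact: ltW.
have PS k : P k.+1 = P k * (X k / g) by exact: arith_prodS.
pose e k := P k.+1 * (phi k - phi k.+1).
have dphi k : phi k - phi k.+1 = g * d / ((g + X k) * (g + X k.+1)).
  rewrite /phi; have := gX0 k; have := gX0 k.+1; rewrite XS => h1 h2; field.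
  by rewrite h1 h2.
have dphi_ge0 k : 0 <= phi k - phi k.+1.
  by rewrite dphi divr_ge0 ?mulr_ge0 ?ltW.
have e_ge0 k : 0 <= e k by rewrite mulr_ge0 ?dphi_ge0// ltW.
have e_le k : e k <= d / g * P k.+1.
  rewrite /e [P _ * _]mulrC ler_wpM2r ?(ltW (P0 _))// dphi ler_pdivrMr ?mulr_gt0//.
  rewrite mulrAC ler_pdivlMr//.
  have := X0 k; rewrite XS; move: (X k) => y y0.
  rewrite -subr_ge0 (_ : _ - _ = d * (g * (2 * y + d) + y * (y + d))); last by ring.
  by rewrite ltW// mulr_gt0// addr_gt0// mulr_gt0// addr_gt0// mulr_gt0.
(* The constant c is the common positive factor of both sides. With y = [X k] the criterion reads y
   (y + d) >= g (g + d), that is y >= g, and so it persists as k grows. *)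
have ratio k : (e k <= e k.+1) = (g * (g + X k.+2) <= X k.+1 * (g + X k)).
  pose c := P k.+1 * g * d / (g + X k.+1) / (g * (g + X k) * (g + X k.+2)).
  have c0 : 0 < c by rewrite !(divr_gt0, mulr_gt0).
  rewrite -[RHS](ler_pM2l c0) /e (PS k.+1) !dphi /c.
  have := gX0 k; have := gX0 k.+1; have := gX0 k.+2.
  move: (X k) (X k.+1) (X k.+2) => u v w h1 h2 h3.
  by congr (_ <= _); field; rewrite ?gn0 ?h1 ?h2 ?h3.
have eU k : e k <= e k.+1 -> e k.+1 <= e k.+2.
  by rewrite !ratio !XS; have := X0 k; move: (X k) => y y0; nra.
(* An exact identity: [phi k * (1 + X k / g)] is 1, so [P k] equals
   [P k * phi k + P k.+1 * phi k]. *)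
have tele n : \sum_(k < n) (-1) ^+ k * P k =
    phi 0%N - (-1) ^+ n * P n * phi n + \sum_(k < n) (-1) ^+ k * e k.
  elim: n => [|n IH].
    by rewrite !big_ord0 addr0 expr0 /P /arith_prod big_ord0 !mul1r subrr.
  rewrite !big_ord_recr /= IH /e exprS PS /phi; have := gX0 n; have := gX0 n.+1.
  move=> h1 h2; field.
  by rewrite gn0 h1 h2 gX0.
have -> : g + x = g + X 0%N by rewrite /X mulr0 addr0.
rewrite -/(X _) -/(phi _) -/(phi _) tele addrC addKr.
apply: le_trans (alternating_unimodal _ e_ge0 eU) _.
rewrite mulrDr lerD//; apply: le_trans (e_le _) _ => //.
by rewrite /P /arith_prod big_ord_recr big_ord0/= mulr0 addr0 mul1r.
Qed.
End AlternatingSums.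

(** * Asymptotics of the normalized products *)

Section Asymptotics.
Variable R : realType.
Implicit Types (n N q : nat).

Lemma ln_div_cvg0 : (ln n%:R / n%:R : R) @[n --> \oo] --> (0 : R).
Proof.
rewrite -cvg_shiftS /=.
apply: (@squeeze_cvgr _ _ _ _ (cst 0) (fun n => 2 * Num.sqrt (harmonic n))).
- apply: nearW => n; rewrite /harmonic /= (sqrtrV (ler0n _ _)).
  have x0 : 0 < n.+1%:R :> R by [].
  rewrite divr_ge0 ?ln_ge0 ?ler1n//= ler_pdivrMr//.
  have s0 : 0 < Num.sqrt n.+1%:R :> R by rewrite sqrtr_gt0.
  have xE : n.+1%:R = Num.sqrt n.+1%:R ^+ 2 :> R by rewrite sqr_sqrtr// ltW.
  rewrite {1 3}xE; move: (Num.sqrt _) s0 => s s0.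
  have -> : 2 / s * s ^+ 2 = 2 * s by field; rewrite gt_eqF.
  by rewrite lnXn// -[leLHS]mulr_natl ler_pM2l// ltW// ln_sublinear.
- exact: cvg_cst.
- rewrite -[X in _ --> X](mulr0 2); apply: cvgM; first exact: cvg_cst.
  rewrite -[X in _ --> X]sqrtr0; apply: continuous_cvg; last exact: cvg_harmonic.
  exact: sqrt_continuous.
Qed.

Let cvg_expR_seq (u : nat -> R) (l : R) :
  u n @[n --> \oo] --> l -> expR (u n) @[n --> \oo] --> expR l.
Proof. by apply: continuous_cvg; exact: continuous_expR. Qed.

Let cX (w : nat -> R) (l : R) m :
  w n @[n --> \oo] --> l -> w n ^+ m @[n --> \oo] --> l ^+ m.
Proof.
move=> h; elim: m => [|m IH]; first exact: cvg_cst.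
by under eq_cvg do rewrite exprS; rewrite exprS; exact: cvgM.
Qed.

(** This is F(1)^(1/q), since F(1) = q! by [Fpoly1]. *)
Definition nroot_fact q : R := (q`!%:R : R) `^ (q%:R^-1).

Lemma nroot_fact_gt0 q : 0 < nroot_fact q.
Proof. by rewrite powR_gt0// ltr0n fact_gt0. Qed.

Lemma nroot_factX q : (0 < q)%N -> nroot_fact q ^+ q = q`!%:R.
Proof.
move=> q0; rewrite -powR_mulrn ?ltW ?nroot_fact_gt0// -powRrM mulVf ?pnatr_eq0 -?lt0n//.
by rewrite powRr1.
Qed.

(** The logarithm of the quotient is 1 minus [stirling_seq] over q minus ln q / (2q). *)
Lemma nroot_fact_cvg : (q%:R / nroot_fact q) @[q --> \oo] --> expR (1 : R).
Proof.
rewrite -cvg_shiftS /=.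
have H : (1 - (stirling_seq R n.+1 * harmonic n + 2^-1 * (ln n.+1%:R / n.+1%:R)))
    @[n --> \oo] --> (1 - (ln (2 * pi) / 2 * 0 + 2^-1 * 0) : R).
  apply: cvgB; first exact: cvg_cst; apply: cvgD.
    by apply: cvgM; [rewrite (cvg_shiftS (stirling_seq R)); exact: stirling_cvg|exact: cvg_harmonic].
  apply: cvgM; first exact: cvg_cst.
  by rewrite (cvg_shiftS (fun n => ln n%:R / n%:R)); exact: ln_div_cvg0.
rewrite !mulr0 addr0 subr0 in H.
have := cvg_expR_seq H.
apply: cvg_trans; apply: near_eq_cvg; apply: nearW => n /=.
have n0 : 0 < n.+1%:R :> R by [].
rewrite -[RHS]lnK ?posrE ?divr_gt0 ?nroot_fact_gt0//; congr expR.
rewrite ln_div ?posrE ?nroot_fact_gt0// ln_powR /stirling_seq /harmonic.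
by move: n0; move: (n.+1%:R) => x x0; field; rewrite gt_eqF.
Qed.

(** 27^N divided by the trinomial coefficient (3N)! / N!^3; by Stirling's formula it is asymptotic
    to 2 pi N / sqrt 3. *)
Definition Qratio N : R := 27 ^+ N * N`!%:R ^+ 3 / (3 * N)`!%:R.

Lemma Qratio_gt0 N : 0 < Qratio N.
Proof. by rewrite divr_gt0 ?mulr_gt0 ?exprn_gt0// ltr0n fact_gt0. Qed.

Definition Qlim : R := expR (ln (2 * pi) - ln 3 / 2).

Lemma Qlim_sqr : Qlim ^+ 2 = (2 * pi) ^+ 2 / 3.
Proof.
have p0 : 0 < 2 * pi :> R by rewrite mulr_gt0// pi_gt0.
rewrite -[RHS]lnK ?posrE ?divr_gt0 ?exprn_gt0// -expRM_natl; congr expR.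
by rewrite ln_div ?posrE ?exprn_gt0// lnXn// -[ln _ *+ 2]mulr_natl; field.
Qed.

Lemma Qratio_cvg : (Qratio N / N%:R) @[N --> \oo] --> Qlim.
Proof.
have H : (3 * stirling_seq R N - stirling_seq R (3 * N)%N - ln 3 / 2) @[N --> \oo]
   --> (3 * (ln (2 * pi) / 2) - ln (2 * pi) / 2 - ln 3 / 2 : R).
  apply: cvgB; last exact: cvg_cst; apply: cvgB.
    by apply: cvgM; [exact: cvg_cst|exact: stirling_cvg].
  apply: (cvg_comp (fun n => 3 * n)%N (stirling_seq R) _ (@stirling_cvg R)).
  by apply: cvg_oo_ge_id => n; rewrite leq_pmull.
have -> : Qlim = expR (3 * (ln (2 * pi) / 2) - ln (2 * pi) / 2 - ln 3 / 2).
  by congr expR; field.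
apply: cvg_trans (cvg_expR_seq H); apply: near_eq_cvg; exists 1%N => // N /= N0.
have n0 : 0 < N%:R :> R by rewrite ltr0n.
have f0 m : 0 < m`!%:R :> R by rewrite ltr0n fact_gt0.
rewrite -[RHS]lnK ?posrE ?divr_gt0 ?Qratio_gt0//; congr expR.
rewrite ln_div ?posrE ?Qratio_gt0//.
rewrite /Qratio ln_div ?posrE ?mulr_gt0 ?exprn_gt0//.
rewrite [ln (27 ^+ N * _)]lnM ?posrE ?exprn_gt0// !lnXn//.
have -> : ln 27 = 3 * ln 3 :> R.
  by rewrite (_ : 27 = 3 ^+ 3) ?lnXn// ?mulr_natl// -natrX.
rewrite /stirling_seq natrM [ln (3 * N%:R)]lnM ?posrE//.
by field.
Qed.

(** Limits are taken after cubing, which removes the cube roots. The inequality (y - x)^3 <= y^3 -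
    x^3 for 0 <= x <= y brings them back. *)
Lemma cvg_cube_inv (w : nat -> R) (a : R) : (forall n, 0 <= w n) -> 0 <= a ->
  w n ^+ 3 @[n --> \oo] --> a ^+ 3 -> w n @[n --> \oo] --> a.
Proof.
move=> w0 a0 H; apply/cvgrPdist_lt => e e0.
have e30 : 0 < e ^+ 3 by rewrite exprn_gt0.
move/cvgrPdist_lt : H => /(_ _ e30); apply: filterS => n h.
have key (x y : R) : 0 <= x -> x <= y -> (y - x) ^+ 3 <= y ^+ 3 - x ^+ 3.
  move=> x0 xy; rewrite -subr_ge0.
  rewrite (_ : _ - _ = 3 * x * y * (y - x)); last by ring.
  by rewrite !mulr_ge0 ?subr_ge0// (le_trans x0).
rewrite -(@ltr_pXn2r _ 3) ?nnegrE ?normr_ge0 ?(ltW e0)//.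
apply: le_lt_trans h.
have [wa|/ltW aw] := leP (w n) a.
  rewrite ger0_norm ?subr_ge0//.
  by apply: le_trans (key _ _ _ wa) (ler_norm _).
rewrite distrC ger0_norm ?subr_ge0// [leRHS]distrC.
by apply: le_trans (key _ _ _ aw) (ler_norm _).
Qed.

Definition gq N : R := nroot_fact (3 * N).+1.

Lemma gq_gt0 N : 0 < gq N. Proof. exact: nroot_fact_gt0. Qed.

Let gq_ratio_cvg : ((3 * N).+1%:R / gq N) @[N --> \oo] --> expR (1 : R).
Proof.
apply: (cvg_comp (fun N => (3 * N).+1) (fun q => q%:R / nroot_fact q) _ nroot_fact_cvg).
by apply: cvg_oo_ge_id => n; rewrite leqW// leq_pmull.
Qed.

Let cvg_3N1V : ((3 * N).+1%:R^-1 : R) @[N --> \oo] --> (0 : R).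
Proof.
apply: (cvg_comp (fun N => 3 * N)%N (@harmonic R) _ cvg_harmonic).
by apply: cvg_oo_ge_id => n; rewrite leq_pmull.
Qed.

Lemma gqV_cvg : (gq N)^-1 @[N --> \oo] --> (0 : R).
Proof.
rewrite -[X in _ --> X](mul0r (expR 1)).
under eq_cvg => N.
  rewrite (_ : (gq N)^-1 = (3 * N).+1%:R^-1 * ((3 * N).+1%:R / gq N)); last first.
    by rewrite mulKf// pnatr_eq0.
  over.
by apply: cvgM.
Qed.

Lemma gq_natr_cvg : (N%:R / gq N) @[N --> \oo] --> (expR 1 / 3 : R).
Proof.
have -> : expR 1 / 3 = (3^-1 - 3^-1 * 0) * expR 1 :> R by ring.
under eq_cvg => N.
  rewrite (_ : N%:R / gq N = (3^-1 - 3^-1 * (3 * N).+1%:R^-1) * ((3 * N).+1%:R / gq N)).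
    over.
  rewrite mulrA; congr (_ / _); rewrite mulrBl -mulrA mulVf ?pnatr_eq0//.
  by rewrite -[(3 * N).+1%:R]natr1 natrM; field.
apply: cvgM => //; apply: cvgB; first exact: cvg_cst.
by apply: cvgM => //; exact: cvg_cst.
Qed.

Lemma gauss_seq_cvg (s : R) : 0 < s < 1 -> gauss_seq s n @[n --> \oo] --> Gamma s.
Proof.
move=> s01.
apply: (@squeeze_cvgr _ _ _ _ (cst (Gamma s)) (fun n => (1 + s * harmonic n) * Gamma s)).
- by apply: nearW => n; rewrite Gamma_le_gauss//= gauss_le_Gamma.
- exact: cvg_cst.
- have E : Gamma s = (1 + s * 0) * Gamma s by rewrite mulr0 addr0 mul1r.
  rewrite [X in _ --> X]E; apply: cvgM; last exact: cvg_cst.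
  apply: cvgD; first exact: cvg_cst.
  by apply: cvgM; [exact: cvg_cst|exact: cvg_harmonic].
Qed.

Lemma arith_prod_fact (g : R) n : arith_prod 3 g 3 n = 3 ^+ n * n`!%:R / g ^+ n.
Proof.
elim: n => [|n IH]; first by rewrite /arith_prod big_ord0 fact0 !expr0 !mul1r invr1.
by rewrite arith_prodS IH factS natrM !exprS -[n.+1%:R]natr1 invfM; ring.
Qed.

Lemma arith_prod_third (g : R) n :
  arith_prod 3 g 1 n = 3 ^+ n * (\prod_(k < n) (k%:R + 3^-1)) / g ^+ n.
Proof.
elim: n => [|n IH]; first by rewrite /arith_prod !big_ord0 !expr0 !mul1r invr1.
rewrite arith_prodS IH.
have -> : 1 + 3 * n%:R = 3 * (n%:R + 3^-1) :> R by field.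
by rewrite big_ord_recr /= !exprS invfM; ring.
Qed.

(* [useq N] and [vseq N] are the normalized products V_i(1) / F(1)^(i/q), with
   q = 3N + 1, at the starts i = N + 1 and i = 2N + 1 of the second and third
   runs of residues. *)
Definition useq N : R := arith_prod 3 (gq N) 1 N.+1.
Definition vseq N : R := useq N * arith_prod 3 (gq N) 3 N.

Lemma useq_gt0 N : 0 < useq N. Proof. by apply: arith_prod_gt0 => //; exact: gq_gt0. Qed.

Lemma vseq_gt0 N : 0 < vseq N.
Proof. by rewrite mulr_gt0 ?useq_gt0//; apply: arith_prod_gt0 => //; exact: gq_gt0. Qed.

Let third01 : 0 < (3^-1 : R) < 1. Proof. by lra. Qed.

(** Cubing turns the exponent 2N + 1 of g into 2 (3N + 1) + 1, so g^(3N + 1) = (3N + 1)! leaves a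
    single g. The product of the k + 1/3 is expressed by [gauss_seq], whose power (N + 1)^(1/3) also
    becomes rational. *)
Lemma vseq_cube N : vseq N ^+ 3 = 27 * Qratio N ^+ 2 * N.+1%:R
  / (gauss_seq (3^-1) N ^+ 3 * (3 * N).+1%:R ^+ 2 * gq N).
Proof.
have hq : gq N ^+ (3 * N).+1 = (3 * N).+1%:R * (3 * N)`!%:R.
  by rewrite nroot_factX// factS natrM.
have g0 := gq_gt0 N.
have P0 : 0 < \prod_(k < N.+1) (k%:R + 3^-1) :> R.
  by apply: prodr_gt0 => k _; rewrite ltr_wpDl.
have c0 : 0 < N.+1%:R `^ (3^-1) :> R by rewrite powR_gt0.
have c3 : N.+1%:R `^ (3^-1) ^+ 3 = N.+1%:R :> R.
  by rewrite -powR_mulrn ?powR_ge0// -powRrM mulVf// powRr1.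
have h3 : (gq N ^+ N.+1 * gq N ^+ N) ^+ 3 = ((3 * N).+1%:R * (3 * N)`!%:R) ^+ 2 * gq N.
  by rewrite -hq -exprD -!exprM -exprSr; congr (_ ^+ _); lia.
rewrite /vseq /useq arith_prod_fact arith_prod_third /Qratio /gauss_seq.
have -> : 27 ^+ N = (3 ^+ N) ^+ 3 :> R.
  by rewrite exprAC; congr (_ ^+ _); ring.
set x := 3 ^+ N; rewrite [3 ^+ N.+1]exprS -/x.
have x0 : 0 < x by rewrite exprn_gt0.
have f0 m : 0 < m`!%:R :> R by rewrite ltr0n fact_gt0.
have gn m : 0 < gq N ^+ m by rewrite exprn_gt0.
have n0 : 0 < (3 * N).+1%:R :> R by [].
have n1 : 0 < N.+1%:R :> R by [].
move: h3 c0 c3 {hq}.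
have := f0 N; have := f0 (3 * N)%N; have := gn N; have := gn N.+1; move: g0 P0 n0 {n1}.
move: (N.+1%:R `^ _) => c; move: (N.+1%:R) => m.
move: (gq N ^+ N) (gq N ^+ N.+1) => a b; move: (gq N) (\prod_(k < _) _) => g P.
move: (N`!%:R) ((3 * N)`!%:R) ((3 * N).+1%:R) => f F q g0 P0 q0 b0 a0 F0 f0' h3 c0 <-.
have -> : 3 * x * P / b * (x * f / a) = 3 * x ^+ 2 * P * f / (b * a).
  by field; rewrite !gt_eqF.
rewrite expr_div_n h3; field.
by rewrite !gt_eqF.
Qed.

Let gauss3_cvg := gauss_seq_cvg third01.

Lemma Gamma_third_gt0 : 0 < Gamma (3^-1 : R).
Proof.
have g0 : 0 < gauss_seq (3^-1) 0 :> R.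
  rewrite /gauss_seq divr_gt0 ?mulr_gt0 ?powR_gt0//.
  by apply: prodr_gt0 => k _; rewrite ltr_wpDl.
by have := lt_le_trans g0 (gauss_le_Gamma 0 third01); rewrite pmulr_rgt0.
Qed.

(** The index n = 0 of Gauss' product already gives 1/s = 3. *)
Lemma Gamma_third_le3 : Gamma (3^-1 : R) <= 3.
Proof.
have := Gamma_le_gauss 0 third01.
by rewrite /gauss_seq big_ord_recr big_ord0 /= powR1 mul1r add0r fact0 !mul1r invrK.
Qed.

Lemma Ahat_gt0 : 0 < Ahat R.
Proof.
have := Gamma_third_gt0; have := @pi_gt0 R => h1 h2.
by rewrite /Ahat divr_gt0 ?mulr_gt0 ?expR_gt0 ?powR_gt0 ?mulr_gt0.
Qed.

Lemma Ahat_cube : Ahat R ^+ 3 = expR 1 * (2 * pi) ^+ 2 / (3 * Gamma (3^-1) ^+ 3).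
Proof.
have p0 : 0 <= 2 * pi :> R by rewrite mulr_ge0// pi_ge0.
rewrite /Ahat expr_div_n !exprMn -expRM_natl.
rewrite -[_ `^ (2 / 3) ^+ 3]powR_mulrn ?powR_ge0// -powRrM divfK//.
rewrite -[_ `^ _ ^+ 3]powR_mulrn ?powR_ge0// -[3 `^ _ `^ _]powRrM mulVf// powRr1//.
by rewrite mulfV// powR_mulrn// exprMn.
Qed.

(** After cubing, the claim is e (2 pi)^2 > 3 Gamma(1/3)^3, whose right side is at most 81. *)
Lemma Ahat_gt1 : 1 < Ahat R.
Proof.
rewrite -(@ltr_pXn2r _ 3) ?nnegrE// ?(ltW Ahat_gt0)// expr1n Ahat_cube.
have G0 := Gamma_third_gt0; have G3 := Gamma_third_le3.
rewrite ltr_pdivlMr ?mulr_gt0 ?exprn_gt0// mul1r.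
have G27 : Gamma (3^-1 : R) ^+ 3 <= 3 ^+ 3 by rewrite lerXn2r ?nnegrE ?(ltW G0).
have pi2 : (2 * (128 / 45)) ^+ 2 <= (2 * pi) ^+ 2 :> R.
  rewrite lerXn2r ?nnegrE//; first by rewrite mulr_ge0 ?pi_ge0.
  by rewrite ler_pM2l// pi_ge_128_45.
(* (9/8)^8 times (256/45)^2 is about 83.04, which exceeds 81. *)
have e1 : (1 + 8^-1) ^+ 8 <= expR 1 :> R.
  have -> : expR 1 = expR (8^-1) ^+ 8 :> R by rewrite -expRM_natl mulfV.
  rewrite lerXn2r ?nnegrE ?expR_ge0 ?expR_ge1Dx//.

have := ler_pM _ _ e1 pi2; rewrite !exprn_ge0 ?mulr_ge0 ?divr_ge0 ?addr_ge0//.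
by move=> /(_ isT isT); lra.
Qed.

Lemma vseq_cvg : vseq N @[N --> \oo] --> Ahat R.
Proof.
apply: cvg_cube_inv => [N||]; [exact/ltW/vseq_gt0|exact/ltW/Ahat_gt0|].
have G0 := Gamma_third_gt0.
have -> : Ahat R ^+ 3 = 27 * Qlim ^+ 2 * (3^-1 - 3^-1 * 0) ^+ 2 * (expR 1 / 3 + 0)
    * (Gamma (3^-1) ^+ 3)^-1.
  by rewrite Ahat_cube Qlim_sqr; field; rewrite gt_eqF.
(* The expression of [vseq_cube] regrouped into convergent factors, using N / (3N + 1) = 1/3 - (1/3)
   / (3N + 1) and (N + 1) / g = N / g + 1 / g. *)
have H : (27 * (Qratio N / N%:R) ^+ 2 * (3^-1 - 3^-1 * (3 * N).+1%:R^-1) ^+ 2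
    * (N%:R / gq N + (gq N)^-1) * (gauss_seq (3^-1) N ^+ 3)^-1) @[N --> \oo] -->
    (27 * Qlim ^+ 2 * (3^-1 - 3^-1 * 0) ^+ 2 * (expR 1 / 3 + 0) * (Gamma (3^-1) ^+ 3)^-1).
  apply: cvgM; last first.
    by apply: cvgV; [rewrite gt_eqF// exprn_gt0|apply: cX; exact: gauss3_cvg].
  apply: cvgM; last by apply: cvgD; [exact: gq_natr_cvg|exact: gqV_cvg].
  apply: cvgM.
    by apply: cvgM; [exact: cvg_cst|apply: cX; exact: Qratio_cvg].
  apply: cX; apply: cvgB; first exact: cvg_cst.
  by apply: cvgM => //; exact: cvg_cst.
apply: cvg_trans H; apply: near_eq_cvg; exists 1%N => // N /= N0.
rewrite vseq_cube.
have : 0 < gauss_seq (3^-1) N :> R by apply: lt_le_trans G0 (Gamma_le_gauss N third01).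
have : 0 < N%:R :> R by rewrite ltr0n.
have := gq_gt0 N.
rewrite -[(3 * N).+1%:R]natr1 natrM -[N.+1%:R]natr1.
move: (N%:R) (gq N) (gauss_seq _ N) (Qratio N) => x g G Q g0 x0 G1.
have x3 : 0 < 3 * x + 1 by rewrite addr_gt0 ?mulr_gt0.
by field; rewrite !gt_eqF.
Qed.

(** The quotient [vseq N / useq N] is 3^N N! / g^N, whose cube is [Qratio N] times g / (3N + 1). As
    [Qratio] grows linearly, [useq] tends to 0. *)
Lemma useq_cube N : useq N ^+ 3 = vseq N ^+ 3 * ((3 * N).+1%:R / gq N) / Qratio N.
Proof.
have hq : gq N ^+ (3 * N).+1 = (3 * N).+1%:R * (3 * N)`!%:R.
  by rewrite nroot_factX// factS natrM.
have g0 := gq_gt0 N.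
rewrite /vseq exprMn arith_prod_fact /Qratio.
have -> : 27 ^+ N = (3 ^+ N) ^+ 3 :> R.
  by rewrite exprAC; congr (_ ^+ _); ring.
have x0 : 0 < (3 ^+ N : R) by rewrite exprn_gt0.
have f0 m : 0 < m`!%:R :> R by rewrite ltr0n fact_gt0.
have h3 : (gq N ^+ N) ^+ 3 = (3 * N).+1%:R * (3 * N)`!%:R / gq N.
  by rewrite -hq -exprM mulnC [in RHS]exprSr mulfK// gt_eqF.
have q0 : 0 < (3 * N).+1%:R :> R by [].
have := f0 N; have := f0 (3 * N)%N.
rewrite expr_div_n h3; move: (3 ^+ N) x0 (gq N) g0 {h3 hq} ((3 * N).+1%:R) q0 => x x0 g g0 q q0 ? ?.
by field; rewrite !gt_eqF.
Qed.

Lemma useq_cvg : useq N @[N --> \oo] --> (0 : R).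
Proof.
apply: cvg_cube_inv => [N||]; [exact/ltW/useq_gt0|by []|].
have Q0 : 0 < Qlim by exact: expR_gt0.
have -> : 0 ^+ 3 = Ahat R ^+ 3 * expR 1 * (Qlim^-1 * 0) :> R by rewrite expr0n !mulr0.
rewrite -cvg_shiftS.
have H : (vseq n.+1 ^+ 3 * ((3 * n.+1).+1%:R / gq n.+1) * ((Qratio n.+1 / n.+1%:R)^-1 * harmonic n))
   @[n --> \oo] --> (Ahat R ^+ 3 * expR 1 * (Qlim^-1 * 0)).
  apply: cvgM.
    apply: cvgM.
      by rewrite (cvg_shiftS (fun n => vseq n ^+ 3)); apply: cX; exact: vseq_cvg.
    by rewrite (cvg_shiftS (fun N => (3 * N).+1%:R / gq N)).
  apply: cvgM; last exact: cvg_harmonic.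
  rewrite (cvg_shiftS (fun n => (Qratio n / n%:R)^-1)).
  by apply: cvgV; [rewrite gt_eqF|exact: Qratio_cvg].
apply: cvg_trans H; apply: near_eq_cvg; apply: nearW => n /=.
rewrite useq_cube /harmonic; congr (_ * _); rewrite invfM invrK -mulrA mulfV ?mulr1//.
Qed.
End Asymptotics.

(** * The limit of Bhat *)

Lemma qhatS m : qhat m.+1 = (3 * (2 * m).+1).+1.
Proof. by rewrite /qhat; lia. Qed.

Lemma cres3_block1 N k : (k <= N)%N -> cres 3 (3 * N).+1 k = (3 * k)%N.
Proof. by move=> kN; rewrite /cres mulnC modn_small// ltnS leq_mul2l kN. Qed.

Lemma cres3_block2 N k : (k < N)%N -> cres 3 (3 * N).+1 (N.+1 + k) = (3 * k + 2)%N.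
Proof.
move=> kN; rewrite /cres (_ : (_ * 3 = 3 * k + 2 + (3 * N).+1)%N); last by lia.
by rewrite modnDr modn_small//; lia.
Qed.

Lemma cres3_block3 N k : (k < N)%N -> cres 3 (3 * N).+1 (N.+1 + N + k) = (3 * k + 1)%N.
Proof.
move=> kN; rewrite /cres (_ : (_ * 3 = 3 * k + 1 + (3 * N).+1 + (3 * N).+1)%N); last by lia.
by rewrite !modnDr modn_small//; lia.
Qed.

Section BhatLimit.
Variable R : realType.
Implicit Types n m N k : nat.

Let wseq N k : R := \prod_(i < k) ((1 + (cres 3 (3 * N).+1 i)%:R) / gq R N).

Let wseqD N a k : wseq N (a + k) =
  wseq N a * \prod_(i < k) ((1 + (cres 3 (3 * N).+1 (a + i))%:R) / gq R N).
Proof. by rewrite /wseq big_split_ord. Qed.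

Let wseq1 N k : (k <= N.+1)%N -> wseq N k = arith_prod 3 (gq R N) 1 k.
Proof.
move=> kN; apply: eq_bigr => i _.
by rewrite cres3_block1 ?natrM// -ltnS (leq_trans (ltn_ord i)).
Qed.

Let wseq2 N k : (k <= N)%N ->
  wseq N (N.+1 + k) = useq R N * arith_prod 3 (gq R N) 3 k.
Proof.
move=> kN; rewrite wseqD wseq1//; congr (_ * _); apply: eq_bigr => i _.
rewrite cres3_block2; last exact: leq_trans (ltn_ord i) kN.
by rewrite natrD natrM; congr (_ / _); ring.
Qed.

Let wseq3 N k : (k <= N)%N ->
  wseq N (N.+1 + N + k) = vseq R N * arith_prod 3 (gq R N) 2 k.
Proof.
move=> kN; rewrite wseqD wseq2//; congr (_ * _); apply: eq_bigr => i _.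
rewrite cres3_block3; last exact: leq_trans (ltn_ord i) kN.
by rewrite natrD natrM; congr (_ / _); ring.
Qed.

Let coprime_3N1 N : coprime 3 (3 * N).+1.
Proof. by rewrite /coprime -[(3 * N).+1]addn1 mulnC gcdnMDl. Qed.

Let Vpoly1 N k : (Vpoly R 3 (3 * N).+1 k).[1] = wseq N k * gq R N ^+ k.
Proof.
rewrite /wseq big_split/= prodr_const card_ord exprVn divfK; last first.
  by rewrite expf_neq0// gt_eqF// gq_gt0.
by rewrite /Vpoly horner_prod; apply: eq_bigr => i _; rewrite !hornerE.
Qed.

Let wseq_last N : wseq N (3 * N).+1 = 1.
Proof.
have := Vpoly1 N (3 * N).+1; rewrite -[Vpoly _ _ _ _]/(Fpoly R 3 (3 * N).+1) Fpoly1//.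
rewrite nroot_factX// => /esym/(canRL (mulfK _)) ->; rewrite ?divff// pnatr_eq0 -lt0n fact_gt0//.
Qed.

(** The third run ends at i = q, where V_q = F makes the normalized product 1. *)
Let vseq_arith_prod N : vseq R N * arith_prod 3 (gq R N) 2 N = 1.
Proof. by rewrite -wseq3// (_ : (N.+1 + N + N = (3 * N).+1)%N) ?wseq_last//; lia. Qed.

Let Bhat_wseq m : let N := (2 * m).+1 in
  Bhat R m.+1 = \sum_(i < (3 * N).+1) (-1) ^+ i * wseq N i.
Proof.
move=> N; rewrite /Bhat qhatS; apply: eq_bigr => i _; congr (_ * _).
rewrite Fpoly1// [i%:R / _]mulrC powRrM -/N.
rewrite (powR_mulrn _ (powR_ge0 _ _)) -/(nroot_fact _ _) -/(gq R N) Vpoly1 mulfK//.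
by rewrite expf_neq0// gt_eqF// gq_gt0.
Qed.

(** The three runs start with the values 1, u, v and, N being odd, with the signs +, +, -. Each
    contributes its two boundary terms and an error from [alternating_arith_prod]. *)
Let Bhat_blocks m : let N := (2 * m).+1 in let g := gq R N in
  let u := useq R N in let v := vseq R N in
  is_true (`|Bhat R m.+1 -
    (g / (g + 1) - u * (g / (g + (1 + 3 * N.+1%:R)))
     + (u * (g / (g + 3)) + v * (g / (g + (3 + 3 * N%:R))))
     - (v * (g / (g + 2)) + g / (g + (2 + 3 * N%:R))))| <=
  3 / g * (1 / g + u + (u * (3 / g) + v) + (v * (2 / g) + 1))).
Proof.
move=> N g u v.
have g0 : 0 < g by exact: gq_gt0.
have u0 : 0 < u by exact: useq_gt0.
have v0 : 0 < v by exact: vseq_gt0.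
have N1 : (-1) ^+ N = -1 :> R by rewrite -signr_odd /N /= oddM.
have h30 : 0 < 3 :> R by [].
have h20 : 0 < 2 :> R by [].
have h10 : 0 < 1 :> R by [].
(* The parameters L = N, 2m, 2m correspond to run lengths N + 1, N, N, since N = 2m + 1. *)
have T1   := alternating_arith_prod N h30 g0 h10.
have T2 := alternating_arith_prod (2 * m) h30 g0 h30.
have T3 := alternating_arith_prod (2 * m) h30 g0 h20.
rewrite -/N -/(useq R N) -/g -/u in T1, T2, T3.
rewrite Bhat_wseq -/N (_ : (3 * N).+1 = (N.+1 + N + N)%N); last by lia.
rewrite !big_split_ord /=.
rewrite (eq_bigr (fun i : 'I_N.+1 => (-1) ^+ i * arith_prod 3 g 1 i)); last first.
  by move=> i _; rewrite wseq1// ltnW.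
rewrite [X in _ + X + _](eq_bigr (fun i : 'I_N => u * ((-1) ^+ i * arith_prod 3 g 3 i))); last first.
  move=> i _; rewrite wseq2 ?(ltnW (ltn_ord i))// exprD exprS N1.
  by rewrite -/u -/g; ring.
rewrite [X in _ + _ + X](eq_bigr (fun i : 'I_N => - (v * ((-1) ^+ i * arith_prod 3 g 2 i)))); last first.
  move=> i _; rewrite wseq3 ?(ltnW (ltn_ord i))// !exprD exprS N1.
  by rewrite -/v -/g; ring.
rewrite sumrN -!mulr_sumr.
have vu : u * arith_prod 3 g 3 N - v = 0 by rewrite subrr.
have v1 : v * arith_prod 3 g 2 N - 1 = 0 by rewrite vseq_arith_prod subrr.
move: T1 T2 T3; rewrite exprS N1 mulrNN !mul1r.
move: (arith_prod 3 g 3 N) (arith_prod 3 g 2 N) vu v1 => p r vu v1.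
move: (\sum_(i < N.+1) _) (\sum_(i < N) _) (\sum_(i < N) _) => S1 S3 S2.
move: (g / (g + 1)) (g / (g + 3)) (g / (g + 2)) => a1 a2 a3.
move: (g / (g + (1 + _))) (g / (g + (3 + _))) (g / (g + (2 + _))) => c1 c2 c3.
set A1 := S1 - _; set A2 := S2 - _; set A3 := S3 - _ => h1 h2 h3.
have -> : S1 + u * S2 - v * S3 - (a1 - u * c1 + (u * a2 + v * c2) - (v * a3 + c3)) =
    A1 + u * A2 - v * A3 + (u * p - v) * c2 - (v * r - 1) * c3.
  by rewrite /A1 /A2 /A3; ring.
rewrite vu v1 !mul0r addr0 subr0.
apply: le_trans (ler_normB _ _) _; rewrite [`|v * _|]normrM (gtr0_norm v0).
have := ler_normD A1 (u * A2); rewrite [`|u * _|]normrM (gtr0_norm u0) => h12.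
have h2' := ler_wpM2l (ltW u0) h2; have h3' := ler_wpM2l (ltW v0) h3.
have -> : 3 / g * (g^-1 + u + (u * (3 / g) + v) + (v * (2 / g) + 1)) =
    3 / g * (g^-1 + u) + u * (3 / g * (3 / g + p)) + v * (3 / g * (2 / g + r))
    - 3 / g * (u * p - v) - 3 / g * (v * r - 1) by ring.
rewrite vu v1 !mulr0 !subr0 lerD//.
by apply: le_trans h12 _; rewrite lerD.
Qed.

Let cvg_near_one (a : R) : 0 <= a ->
  gq R N / (gq R N + a) @[N --> \oo] --> (1 : R).
Proof.
move=> a0.
have H : (1 + a * (gq R N)^-1)^-1 @[N --> \oo] --> ((1 + a * 0)^-1 : R).
  apply: cvgV; first by rewrite mulr0 addr0 oner_neq0.
  apply: cvgD; first exact: cvg_cst.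
  by apply: cvgM; [exact: cvg_cst|exact: gqV_cvg].
rewrite mulr0 addr0 invr1 in H.
apply: cvg_trans H; apply: near_eq_cvg; apply: nearW => N /=.
have g0 := gq_gt0 R N.
by field; rewrite !gt_eqF ?ltr_wpDr.
Qed.

(** The weight at the end of a run, where the factor is close to 3N and 3N / g tends to e; k absorbs
    the extra step of the first run. *)
Let cvg_near_e (a : R) k : 0 <= a ->
  gq R N / (gq R N + (a + 3 * (N + k)%:R)) @[N --> \oo] --> ((1 + expR 1)^-1 : R).
Proof.
move=> a0.
have -> : 1 + expR 1 = 1 + (a + 3 * k%:R) * 0 + 3 * (expR 1 / 3) :> R by field.
have H : (1 + (a + 3 * k%:R) * (gq R N)^-1 + 3 * (N%:R / gq R N))^-1 @[N --> \oo] -->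
    ((1 + (a + 3 * k%:R) * 0 + 3 * (expR 1 / 3))^-1 : R).
  apply: cvgV.
    rewrite mulr0 addr0 mulrC divfK// gt_eqF// addr_gt0 ?expR_gt0//.
  apply: cvgD.
    apply: cvgD; first exact: cvg_cst.
    by apply: cvgM; [exact: cvg_cst|exact: gqV_cvg].
  by apply: cvgM; [exact: cvg_cst|exact: gq_natr_cvg].
apply: cvg_trans H; apply: near_eq_cvg; apply: nearW => N /=.
have g0 := gq_gt0 R N; rewrite natrD.
have : 0 <= N%:R :> R by []. have : 0 <= k%:R :> R by [].
move: (N%:R) (k%:R) (gq R N) g0 => x y g g0 y0 x0.
have h : 0 < g + (a + 3 * (x + y)) by rewrite ltr_wpDr// addr_ge0// mulr_ge0// addr_ge0.
by field; rewrite !gt_eqF//; move: h; congr (_ < _); ring.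
Qed.

Lemma Bhat_cvg : Bhat R n @[n --> \oo] --> expR 1 / (expR 1 + 1) * (1 - Ahat R).
Proof.
rewrite -cvg_shiftS /=.
(* [M] gathers the boundary terms and [E] the error bound of [Bhat_blocks], for all N; only odd N
   are used, through [odd_cvg]. *)
pose M N := gq R N / (gq R N + 1) - useq R N * (gq R N / (gq R N + (1 + 3 * (N + 1)%:R)))
  + (useq R N * (gq R N / (gq R N + 3)) + vseq R N * (gq R N / (gq R N + (3 + 3 * (N + 0)%:R))))
  - (vseq R N * (gq R N / (gq R N + 2)) + gq R N / (gq R N + (2 + 3 * (N + 0)%:R))).
pose e := (1 + expR 1 : R)^-1.
have cu := @useq_cvg R; have cv := @vseq_cvg R; have cg := @gqV_cvg R.
have M_cvg : M N @[N --> \oo] --> (1 - 0 * e + (0 * 1 + Ahat R * e) - (Ahat R * 1 + e)).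
  apply: cvgB.
    apply: cvgD.
      by apply: cvgB; [exact: cvg_near_one|apply: cvgM => //; exact: cvg_near_e].
    by apply: cvgD; apply: cvgM => //; [exact: cvg_near_one|exact: cvg_near_e].
  by apply: cvgD; [apply: cvgM => //; exact: cvg_near_one|exact: cvg_near_e].
pose E N := 3 * (gq R N)^-1 * (1 * (gq R N)^-1 + useq R N
  + (useq R N * (3 * (gq R N)^-1) + vseq R N) + (vseq R N * (2 * (gq R N)^-1) + 1)).
have E_cvg : E N @[N --> \oo] --> (3 * 0 * (1 * 0 + 0 + (0 * (3 * 0) + Ahat R) + (Ahat R * (2 * 0) + 1)) : R).
  have cgM (c : R) : c * (gq R N)^-1 @[N --> \oo] --> c * 0.
    by apply: cvgM => //; exact: cvg_cst.
  apply: cvgM => //; apply: cvgD.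
    by apply: cvgD; apply: cvgD => //; apply: cvgM.
  by apply: cvgD; [apply: cvgM|exact: cvg_cst].
rewrite mulr0 mul0r in E_cvg.
have odd_cvg (w : nat -> R) (l : R) : w n @[n --> \oo] --> l -> w (2 * n).+1 @[n --> \oo] --> l.
  move=> h; apply: (cvg_comp (fun n => (2 * n).+1) w _ h).
  by apply: cvg_oo_ge_id => n; rewrite leqW// leq_pmull.
have -> : expR 1 / (expR 1 + 1) * (1 - Ahat R) =
    1 - 0 * e + (0 * 1 + Ahat R * e) - (Ahat R * 1 + e) + 0.
  by rewrite /e; field; rewrite ?gt_eqF ?addr_gt0 ?expR_gt0.
have D_cvg : Bhat R n.+1 - M (2 * n).+1 @[n --> \oo] --> (0 : R).
  apply/cvgr0Pnorm_le => d d0; have := odd_cvg _ _ E_cvg.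
  move=> /cvgr0Pnorm_le /(_ _ d0); apply: filterS => n.
  apply: le_trans; apply: le_trans (ler_norm _).
  by have := Bhat_blocks n; rewrite /M /E addn1 addn0.
have H : (M (2 * n).+1 + (Bhat R n.+1 - M (2 * n).+1)) @[n --> \oo]
    --> (1 - 0 * e + (0 * 1 + Ahat R * e) - (Ahat R * 1 + e) + 0).
  by apply: cvgD => //; exact: odd_cvg.
apply: cvg_trans H; apply: near_eq_cvg; apply: nearW => n /=.
by rewrite addrC subrK.
Qed.
End BhatLimit.

(** * Hankel matrices of periodic sequences *)

Lemma sum_periodic (V : nmodType) (q : nat) (f : nat -> V) (i : nat) :
  (forall k, f (q + k)%N = f k) -> \sum_(j < q) f (i + j)%N = \sum_(j < q) f j.
Proof.
move=> fq; elim: i => [|i IH]; first by [].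
rewrite -[RHS]IH; case: q fq {IH} => [|q] fq; first by rewrite !big_ord0.
rewrite big_ord_recr [RHS]big_ord_recl /= addrC addn0; congr (_ + _).
  by rewrite addSn -addnS addnC fq.
by apply: eq_bigr => j _; rewrite /bump /= add1n addSn addnS.
Qed.

Lemma prim_root_exists (C : numClosedFieldType) n : (0 < n)%N ->
  {z : C | n.-primitive_root z}.
Proof.
move=> n_gt0; have [r Er] := closed_field_poly_normal ('X^n - 1 : {poly C}).
rewrite (monicP (monicXnsubC 1 n_gt0)) scale1r in Er.
apply/sigW; suff /hasP[z _ z_prim] : has n.-primitive_root r by exists z.
apply: has_prim_root => //.
- by apply/allP => z; rewrite -root_prod_XsubC -Er.
- by rewrite -separable_prod_XsubC -Er separable_Xn_sub_1// pnatr_eq0 -lt0n.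
- by rewrite -ltnS -(size_prod_XsubC r id) -Er size_XnsubC.
Qed.

Section HankelPeriodic.
Variables (C : fieldType) (q : nat) (w : C).
Hypothesis w_prim : q.-primitive_root w.
Implicit Types (W : nat -> C) (i k : nat).

Definition hankel (A : pzRingType) n (W : nat -> A) : 'M[A]_n := \matrix_(i, j) W (i + j)%N.

Definition dft W k : C := \sum_(j < q) W j * w ^+ (j * k).

(** The periodic unit impulse. Its Fourier coefficients are all 1, so its Hankel determinant is the
    constant of [det_hankel_dft]; only its being nonzero matters. *)
Definition periodic_delta (A : pzRingType) n k : A := (n %| k)%:R.

Let fourier (z : C) : 'M[C]_q := Vandermonde q (\row_j z ^+ j).

Let fourier_neq0 (z : C) : (forall i j : 'I_q, z ^+ i = z ^+ j -> i = j) ->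
  \det (fourier z) != 0.
Proof.
move=> z_inj; rewrite det_Vandermonde; apply/prodf_neq0 => i _; apply/prodf_neq0 => j ij.
by rewrite !mxE subr_eq0; apply: contraTneq ij => /z_inj ->; rewrite ltnn.
Qed.

Let w_inj (i j : 'I_q) : w ^+ i = w ^+ j -> i = j.
Proof.
move/eqP; rewrite (eq_prim_root_expr w_prim) !modn_small// => /eqP.
exact: val_inj.
Qed.

Let hankel_dft W i k : (forall k, W (q + k)%N = W k) ->
  w ^+ (i * k) * (\sum_(j < q) W (i + j)%N * w ^+ (j * k)) = dft W k.
Proof.
move=> Wq; rewrite mulr_sumr /dft.
rewrite -[RHS](@sum_periodic _ _ (fun j => W j * w ^+ (j * k)) i).
  by apply: eq_bigr => j _; rewrite mulnDl exprD; ring.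
by move=> j; rewrite Wq mulnDl exprD exprM (prim_expr_order w_prim) expr1n mul1r.
Qed.

Let q_gt0 : (0 < q)%N. Proof. exact: prim_order_gt0 w_prim. Qed.

Let w_neq0 : w != 0.
Proof.
apply: contraTneq q_gt0 => w0; have := prim_expr_order w_prim.
by rewrite w0 expr0n; case: (q) => // n /eqP; rewrite eq_sym oner_eq0.
Qed.

Lemma dft_delta k : dft (periodic_delta C q) k = 1.
Proof.
rewrite /dft /periodic_delta; case: (q) q_gt0 => // n _.
rewrite big_ord_recl big1 ?addr0 => [|i _].
  by rewrite /= mul0n expr0 mulr1.
by rewrite lift0 gtnNdvd ?mul0r// ltnS.
Qed.

Let hankel_fourier W (i k : 'I_q) : (forall k, W (q + k)%N = W k) ->
  (hankel q W *m fourier w) i k = w^-1 ^+ (i * k) * dft W k.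
Proof.
move=> Wq; rewrite exprVn; apply: (canRL (mulKf _)); first by rewrite expf_neq0.
rewrite -(hankel_dft i k Wq) mxE; congr (_ * _).
by apply: eq_bigr => j _; rewrite !mxE -exprM mulnC.
Qed.

Let periodic_deltaD k : periodic_delta C q (q + k) = periodic_delta C q k.
Proof. by rewrite /periodic_delta dvdn_addr. Qed.

(** Multiplying a periodic Hankel matrix by [fourier w] gives [fourier w^-1] times the diagonal
    matrix of Fourier coefficients. Comparison with the impulse eliminates [fourier w^-1]. *)
Lemma det_hankel_dft W : (forall k, W (q + k)%N = W k) ->
  \det (hankel q W) = \det (hankel q (periodic_delta C q)) * \prod_(k < q) dft W k.
Proof.
move=> Wq; apply: (mulIf (fourier_neq0 w_inj)).
have -> : \det (hankel q (periodic_delta C q)) * \prod_(k < q) dft W k * \det (fourier w)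
    = \det (hankel q (periodic_delta C q) *m fourier w *m diag_mx (\row_k dft W k)).
  rewrite !det_mulmx det_diag mulrAC; congr (_ * _).
  by apply: eq_bigr => k _; rewrite mxE.
rewrite -det_mulmx; congr (\det _); apply/matrixP => i k.
by rewrite mul_mx_diag hankel_fourier// mxE hankel_fourier// dft_delta mulr1 mxE.
Qed.

Lemma det_hankel_delta_neq0 : \det (hankel q (periodic_delta C q)) != 0.
Proof.
have : \det (fourier w^-1) != 0.
  by apply: fourier_neq0 => i j; rewrite !exprVn => /invr_inj/w_inj.
apply: contraNneq => D0.
have -> : fourier w^-1 = hankel q (periodic_delta C q) *m fourier w.
  apply/matrixP => i k; rewrite hankel_fourier// dft_delta mulr1 !mxE -exprM.
  by rewrite mulnC.
by rewrite det_mulmx D0 mul0r.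
Qed.
End HankelPeriodic.

Lemma prod_pair_opposite (A : comPzRingType) (h : nat) (f : nat -> A) :
  \prod_(k < 2 * h.+1) f k =
  f 0%N * f h.+1 * \prod_(k < h) (f k.+1 * f (2 * h.+1 - k.+1)%N).
Proof.
rewrite (_ : 2 * h.+1 = h.+1 + h.+1)%N; last by rewrite mul2n addnn.
rewrite big_split_ord /= !big_ord_recl /= big_split /= addn0.
rewrite mulrACA -!mulrA; congr (_ * (_ * _)).
congr (_ * _).
rewrite (reindex_inj rev_ord_inj); apply: eq_bigr => i _; congr f.
by rewrite /bump /=; have := ltn_ord i; lia.
Qed.

Lemma prim_root_norm (C : numClosedFieldType) q (w : C) :
  q.-primitive_root w -> `|w| = 1.
Proof.
move=> w_prim; have q0 := prim_order_gt0 w_prim.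
have /eqP : `|w| ^+ q = 1 by rewrite -normrX (prim_expr_order w_prim) normr1.
by rewrite pexprn_eq1// gtn_eqF//= => /eqP.
Qed.

Lemma prim_root_conj (C : numClosedFieldType) q (w : C) :
  q.-primitive_root w -> w^* = w^-1.
Proof. by move=> /prim_root_norm w1; rewrite invC_norm w1 expr1n invr1 mul1r. Qed.

(** For real W the coefficients at k and q - k are conjugate. The two unpaired indices 0 and q/2
    give the plain and the alternating sum, because w^(q/2) = -1. *)
Lemma prod_dft_real (C : numClosedFieldType) h (w : C) (W : nat -> C) :
  (2 * h.+1).-primitive_root w -> (forall k, W k \is Num.real) ->
  \prod_(k < 2 * h.+1) dft (2 * h.+1) w W k =
  (\sum_(j < 2 * h.+1) W j) * (\sum_(j < 2 * h.+1) (-1) ^+ j * W j) *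
  \prod_(k < h) `|dft (2 * h.+1) w W k.+1| ^+ 2.
Proof.
move=> w_prim Wreal; set q := (2 * h.+1)%N.
have wq : w ^+ q = 1 := prim_expr_order w_prim.
have wh : w ^+ h.+1 = -1.
  have : (w ^+ h.+1) ^+ 2 == 1 by rewrite -exprM mulnC wq.
  rewrite sqrf_eq1 => /orP[|/eqP//].
  by rewrite -(prim_order_dvd w_prim) => /dvdn_leq; rewrite /= mul2n -addnn; lia.
rewrite prod_pair_opposite; congr (_ * _ * _).
- by apply: eq_bigr => j _; rewrite muln0 expr0 mulr1.
- by apply: eq_bigr => j _; rewrite mulnC exprM wh mulrC.
apply: eq_bigr => k _; rewrite normCK; congr (_ * _).
rewrite /dft rmorph_sum; apply: eq_bigr => j _.
rewrite rmorphM rmorphXn /= (prim_root_conj w_prim) (CrealP (Wreal _)); congr (_ * _).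
have w0 : w != 0.
  by apply: contraTneq (oner_neq0 C) => w0; rewrite -wq w0 expr0n /= eqxx.
have wj0 : w ^+ (j * k.+1) != 0 by rewrite expf_neq0.
rewrite exprVn; apply: (mulfI wj0); rewrite mulfV//.
have kq : (k.+1 <= q)%N by rewrite /q; have := ltn_ord k; lia.
by rewrite -exprD -mulnDr subnKC// mulnC exprM wq expr1n.
Qed.

Section RealHankel.
Variable R : rcfType.
Local Open Scope complex_scope.
Let toC : {rmorphism R -> R[i]} := real_complex R.

Let map_hankel q (W : nat -> R) :
  toC (\det (hankel q W)) = \det (hankel q (toC \o W)).
Proof.
by rewrite -det_map_mx; congr (\det _); apply/matrixP => i j; rewrite !mxE.
Qed.

Lemma det_hankel_delta_real_neq0 q : (0 < q)%N -> \det (hankel q (periodic_delta R q)) != 0.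
Proof.
move=> q0; have [w w_prim] := prim_root_exists (R[i] : numClosedFieldType) q0.
rewrite -(fmorph_eq0 toC) map_hankel.
have := det_hankel_delta_neq0 w_prim; congr (\det (hankel _ _) != 0).
by apply/funext => k; rewrite /periodic_delta /= rmorph_nat.
Qed.

(* [P] is the product of the squared moduli of the Fourier coefficients other than
   those at [1] and [-1]; these pair off under conjugation. *)
Lemma det_hankel_even q h (W : nat -> R) : q = (2 * h.+1)%N ->
  (forall k, W (q + k)%N = W k) ->
  exists P, [/\ 0 <= P,
    \sum_(j < q.-1) `|W j.+1| < W 0%N -> 0 < P &
    \det (hankel q W) = \det (hankel q (periodic_delta R q)) *
      ((\sum_(j < q) W j) * (\sum_(j < q) (-1) ^+ j * W j) * P)].
Proof.
move=> qE; subst q; set q := (2 * h.+1)%N => Wq; have [w w_prim] := prim_root_exists (R[i] : numClosedFieldType) (isT : (0 < q)%N).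
pose d k : R[i] := `|dft q w (toC \o W) k.+1| ^+ 2.
pose e k : R := complex.Re (d k).
have dR k : toC (e k) = d k.
  by apply: RRe_real; apply: realX; exact: normr_real.
have d0 k : 0 <= e k by rewrite -ler0c -[_%:C]/(toC _) dR exprn_ge0.
exists (\prod_(k < h) e k); split.
- by apply: prodr_ge0.
- move=> Wsmall; apply: prodr_gt0 => k _; rewrite lt_def d0 andbT.
  rewrite -(fmorph_eq0 toC) dR expf_eq0 /= normr_eq0.
  (* If a coefficient vanished, W 0 would be minus a sum of terms of modulus |W (j + 1)|. *)
  apply: contraTneq Wsmall => D0; rewrite -leNgt.
  have nC x : `|toC x| = toC `|x|.
    have [x0|x0] := lerP 0 x.
      have xc : 0 <= toC x by rewrite -[toC x]/(x%:C) ler0c.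
      by rewrite (ger0_norm xc) (ger0_norm x0).
    have xc : toC x < 0 by rewrite -[toC x]/(x%:C) (ltcR x 0).
    by rewrite (ltr0_norm xc) (ltr0_norm x0) rmorphN.
  apply: le_trans (ler_norm _) _; rewrite -lecR -!/(toC _) -nC rmorph_sum.
  move: D0; rewrite /dft (_ : q = q.-1.+1)// big_ord_recl /= expr0 mulr1.
  move=> /(canRL (addrK _)); rewrite sub0r => ->; rewrite normrN.
  apply: le_trans (ler_norm_sum _ _ _) _; apply: ler_sum => j _.
  by rewrite normrM normrX (prim_root_norm w_prim) expr1n mulr1 -nC.
apply: (fmorph_inj toC); rewrite map_hankel !rmorphM /= map_hankel.
have -> : toC \o periodic_delta R q = periodic_delta R[i] q.
  by apply/funext => k; rewrite /periodic_delta /= rmorph_nat.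
rewrite (det_hankel_dft w_prim) => [|k]; last by rewrite /= Wq.
rewrite prod_dft_real//; last by move=> k; rewrite complex_real.
congr (_ * (_ * _ * _)).
- by rewrite rmorph_sum.
- by rewrite rmorph_sum; apply: eq_bigr => j _; rewrite rmorphM rmorphXn rmorphN1.
- by rewrite rmorph_prod; apply: eq_bigr => k _; rewrite dR.
Qed.
End RealHankel.

(** * Sign changes of polynomials *)

Section SignChange.
Variable R : realType.
Implicit Types (p g : {poly R}) (a x y z : R).

Lemma poly_sign_near g a : ~~ root g a ->
  exists2 e : R, 0 < e & forall t, a - e < t < a + e -> 0 < g.[t] * g.[a].
Proof.
move=> ga; have g0 : g.[a] != 0 by [].
have c0 : 0 < `|g.[a]| by rewrite normr_gt0.
have /cvgrPdist_lt/(_ _ c0) := @continuous_horner _ g a.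
move=> /nbhs_ballP[e /= e0 he]; exists e => // t /andP[ta tb].
have : `|g.[a] - g.[t]| < `|g.[a]|.
  by apply: he; rewrite /ball/= ltr_norml; apply/andP; split; lra.
have [ag|ag] := ltP 0 g.[a].
  by rewrite (gtr0_norm ag) ltr_norml => /andP[h1 h2]; rewrite mulr_gt0//; lra.
have ag' : g.[a] < 0 by rewrite lt_neqAle g0.
by rewrite (ltr0_norm ag') ltr_norml => /andP[h1 h2]; rewrite nmulr_lgt0//; lra.
Qed.

(** A root given by the intermediate value theorem may have even multiplicity. Its factor is then
    divided out, which keeps the signs elsewhere, and induction on the size applies to the
    quotient. *)
Lemma sign_changing_zero_between p x y : x < y -> p.[x] * p.[y] < 0 ->
  exists2 z, x < z < y & sign_changing_zero p z.
Proof.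
move=> xy; have [n] := ubnP (size p); elim: n p => // n IH p sp pxy.
have p0 : p != 0 by apply: contraTN pxy => /eqP ->; rewrite !horner0 mul0r ltxx.
have px0 : p.[x] != 0 by apply: contraTN pxy => /eqP ->; rewrite mul0r ltxx.
have py0 : p.[y] != 0 by apply: contraTN pxy => /eqP ->; rewrite mulr0 ltxx.
have [a axy pa] : exists2 a, x <= a <= y & root p a.
  have [px|px] := ltP p.[x] 0.
    apply: (@poly_ivt R p x y (ltW xy)); rewrite (ltW px)/=.
    by move: pxy; rewrite nmulr_rlt0// => /ltW.
  have px' : 0 < p.[x] by rewrite lt_neqAle eq_sym px0.
  have [|a axy] := @poly_ivt R (- p) x y (ltW xy).
    by rewrite !hornerN oppr_le0 px oppr_ge0/=; move: pxy; rewrite pmulr_rlt0// => /ltW.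
  by rewrite rootN => pa; exists a.
have xa : x < a.
  by rewrite lt_neqAle; case/andP: axy => -> _; rewrite andbT; apply: contraNneq px0 => ->.
have ay : a < y.
  by rewrite lt_neqAle; case/andP: axy => _ ->; rewrite andbT; apply: contraNneq py0 => <-.
have [m [g]] := multiplicity_XsubC p a; rewrite p0 /= => ga pE.
have hE t : p.[t] = g.[t] * (t - a) ^+ m by rewrite pE hornerM horner_exp hornerXsubC.
have m0 : (0 < m)%N by case: m pE hE => // pE _; move: pa; rewrite pE expr0 mulr1 (negPf ga).
have g0 : g != 0 by apply: contraNneq ga => ->; exact: root0.
have sg : (size g < size p)%N.
  by rewrite pE size_Mmonic ?monic_exp ?monicXsubC// size_exp_XsubC addnS /= -addn1 leq_add2l.
have [om|em] := boolP (odd m).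
  exists a; first by rewrite xa.
  split=> //; have [e e0 he] := poly_sign_near ga; exists e => // u v /andP[u1 u2] /andP[v1 v2].
  have gu : 0 < g.[u] * g.[a] by apply: he; rewrite u1/=; lra.
  have gv : 0 < g.[v] * g.[a] by apply: he; rewrite v2 andbT; lra.
  have guv : 0 < g.[u] * g.[v].
    have := mulr_gt0 gu gv; rewrite mulrACA -expr2 pmulr_lgt0//.
    by rewrite exprn_even_gt0.
  rewrite !hE mulrACA pmulr_rlt0// nmulr_rlt0 ?exprn_odd_lt0 ?subr_lt0//.
  by rewrite exprn_gt0 ?subr_gt0.
have even_pos t : t != a -> 0 < (t - a) ^+ m.
  by move=> ta; rewrite exprn_even_gt0// subr_eq0 ta orbT.
have gxy : g.[x] * g.[y] < 0.
  move: pxy; rewrite !hE mulrACA pmulr_llt0// mulr_gt0 ?even_pos//.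
    by rewrite lt_eqF.
  by rewrite gt_eqF.
have [z zxy [gz [e e0 he]]] := IH g (leq_trans sg sp) gxy.
exists z => //; split; first by rewrite pE rootM gz.
have za : z != a by apply: contraNneq ga => <-.
have d0 : 0 < `|z - a| by rewrite normr_gt0 subr_eq0.
(* This radius keeps the removed root a outside the window, so the even power of X - a is positive
   on it. *)
exists (Num.min e `|z - a|); first by rewrite lt_min e0.
have noa t : `|t - z| < `|z - a| -> t != a.
  by apply: contraTneq => ->; rewrite distrC ltxx.
move=> u v /andP[u1 u2] /andP[v1 v2].
have [he1 he2] : Num.min e `|z - a| <= e /\ Num.min e `|z - a| <= `|z - a|.
  by rewrite !ge_min !lexx orbT.
rewrite !hE mulrACA pmulr_llt0.
  by apply: he; apply/andP; split => //; lra.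
rewrite mulr_gt0// even_pos//; apply: noa.
  by rewrite ltr0_norm ?subr_lt0//; lra.
by rewrite gtr0_norm ?subr_gt0//; lra.
Qed.
End SignChange.

(** * Sign changes of Dpoly *)

Lemma cresD r q k : cres r q (q + k) = cres r q k.
Proof. by rewrite /cres mulnDl [(q * r)%N]mulnC modnMDl. Qed.

Section DpolySign.
Variables (R : realType) (r q : nat).
Hypothesis q_gt0 : (0 < q)%N.
Implicit Types (z g : R) (k : nat).

Let V z k : R := (Vpoly R r q k).[z].

Let VE z k : V z k = \prod_(m < k) (z + (cres r q m)%:R).
Proof. by rewrite /V /Vpoly horner_prod; apply: eq_bigr => m _; rewrite !hornerE. Qed.

Let V_gt0 z k : 0 < z -> 0 < V z k.
Proof. by move=> z0; rewrite VE; apply: prodr_gt0 => m _; rewrite ltr_wpDr. Qed.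

Let VD z i j : V z (i + j) = V z i * \prod_(m < j) (z + (cres r q (i + m))%:R).
Proof. by rewrite !VE big_split_ord. Qed.

Let W z g k : R := V z k / g ^+ k.

Let W_gt0 z g k : 0 < z -> 0 < g -> 0 < W z g k.
Proof. by move=> z0 g0; rewrite divr_gt0 ?V_gt0 ?exprn_gt0. Qed.

Let WD z g k : 0 < g -> g ^+ q = V z q -> W z g (q + k) = W z g k.
Proof.
move=> g0 gq; have gn0 m : g ^+ m != 0 by rewrite gt_eqF// exprn_gt0.
rewrite /W VD exprD -gq -mulf_div divff// mul1r VE; congr (_ / _).
by apply: eq_bigr => m _; rewrite cresD.
Qed.

Lemma Dpoly_hankel z g : 0 < z -> 0 < g -> (Dpoly R r q).[z] =
  \prod_(i < q) (W z g i)^-1 * \prod_(j < q) g ^+ j * \det (hankel q (W z g)).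
Proof.
move=> z0 g0; rewrite /Dpoly -[LHS]/(horner_eval z _) -det_map_mx.
have -> : \prod_(i < q) (W z g i)^-1 * \prod_(j < q) g ^+ j * \det (hankel q (W z g)) =
    \det (diag_mx (\row_i (W z g i)^-1) *m hankel q (W z g) *m diag_mx (\row_j g ^+ j)).
  rewrite !det_mulmx !det_diag mulrAC; congr (_ * _ * _).
    by apply: eq_bigr => i _; rewrite mxE.
  by apply: eq_bigr => i _; rewrite mxE.
congr (\det _); apply/matrixP => i j; rewrite mul_mx_diag mul_diag_mx !mxE /= /horner_eval.
rewrite horner_prod.
rewrite (eq_bigr (fun m : 'I_j => z + (cres r q (i + m))%:R)); last first.
  by move=> m _; rewrite !hornerE.
have := V_gt0 i z0; have := exprn_gt0 i g0; have := exprn_gt0 j g0.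
rewrite /W VD exprD => h1 h2 h3; field.
by rewrite !gt_eqF.
Qed.

(** Lets z vary in [Bhat]: for r = 3 and q = [qhat n], the value at 1 is [Bhat R n] by
    conversion. *)
Definition alt_sum z : R := \sum_(i < q)
  (-1) ^+ i * ((Vpoly R r q i).[z] / (Fpoly R r q).[z] `^ (i%:R / q%:R)).

Let groot z : R := (Fpoly R r q).[z] `^ q%:R^-1.

Let groot_gt0 z : 0 < z -> 0 < groot z.
Proof. by move=> z0; rewrite powR_gt0// V_gt0. Qed.

Let grootX z : 0 < z -> groot z ^+ q = V z q.
Proof.
move=> z0; have F0 := V_gt0 q z0.
by rewrite -powR_mulrn ?powR_ge0// -powRrM mulVf ?pnatr_eq0 -?lt0n// powRr1// ltW.
Qed.

Let alt_sumE z : alt_sum z = \sum_(i < q) (-1) ^+ i * W z (groot z) i.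
Proof.
apply: eq_bigr => i _; congr (_ * (_ / _)).
by rewrite [i%:R / _]mulrC powRrM (powR_mulrn _ (powR_ge0 _ _)).
Qed.

(** P collects the row and column scalings, the positive sum of the W_j and the squared moduli. It
    may vanish, but wherever D does not, the sign of D is that of the constant times [alt_sum]. *)
Lemma Dpoly_alt_sum h z : q = (2 * h.+1)%N -> 0 < z -> exists P, [/\ 0 <= P,
  \sum_(j < q.-1) W z (groot z) j.+1 < 1 -> 0 < P &
  (Dpoly R r q).[z] = \det (hankel q (periodic_delta R q)) * P * alt_sum z].
Proof.
move=> qE z0; have g0 := groot_gt0 z0; have Wq k := WD k g0 (grootX z0).
have W0 : W z (groot z) 0 = 1 by rewrite /W VE big_ord0 expr0 divr1.
rewrite (Dpoly_hankel z0 g0) alt_sumE.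
have [P [P0 Psmall ->]] := det_hankel_even qE Wq.
set c1 := \prod_(i < _) _; set c2 := \prod_(i < _) _.
have c10 : 0 < c1 by apply: prodr_gt0 => i _; rewrite invr_gt0 W_gt0.
have c20 : 0 < c2 by apply: prodr_gt0 => i _; rewrite exprn_gt0.
set S := \sum_(j < q) W z (groot z) j.
have S0 : 0 < S.
  rewrite /S (bigD1 (Ordinal q_gt0))//= ltr_pwDl ?W_gt0// sumr_ge0// => i _.
  by rewrite ltW// W_gt0.
exists (c1 * c2 * S * P); split.
- by apply: mulr_ge0 => //; rewrite ltW// !mulr_gt0.
- move=> h1; rewrite !mulr_gt0// Psmall// W0; apply: le_lt_trans h1.
  by apply: ler_sum => j _; rewrite ger0_norm// ltW// W_gt0.
- by ring.
Qed.

(* At [z = w ^ q] with [w] small, every normalized product but the first is at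
   most [w] times a constant, since [z <= F(z)]. *)
Let W_small : coprime r q -> exists2 z, 0 < z < 1 &
  \sum_(j < q.-1) W z (groot z) j.+1 < 1.
Proof.
move=> crq; pose f m : R := 1 + (cres r q m)%:R.
pose M : R := \prod_(m < q) f m.
have f1 (m : nat) : 1 <= f m by rewrite lerDl.
have prod_ge1 a n : 1 <= \prod_(m < n) f (a + m)%N.
  by elim: n => [|n IH]; rewrite ?big_ord0// big_ord_recr /= mulr_ege1.
have M1 : 1 <= M by exact: (prod_ge1 0).
have c0 : cres r q 0 = 0 by rewrite /cres mul0n mod0n.
have M0 : 0 < M by apply: lt_le_trans M1.
pose n : R := q.+1%:R; have n0 : 0 < n by [].
have n1 : 1 < n by rewrite /n ltr1n ltnS.
(* With this w each of the q - 1 terms is at most w M = 1 / (q + 1), so their sum stays below 1. *)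
pose w := (n * M)^-1; have w0 : 0 < w by rewrite invr_gt0 mulr_gt0.
have w1 : w < 1.
  by rewrite invf_lt1 ?mulr_gt0//; apply: lt_le_trans n1 _; rewrite ler_peMr// ltW.
have z0 : 0 < w ^+ q by rewrite exprn_gt0.
have z1 : w ^+ q < 1 by rewrite exprn_ilt1 ?(ltW w0) -?lt0n.
exists (w ^+ q); first by rewrite z0.
have gw : w <= groot (w ^+ q).
  rewrite -(@ler_pXn2r _ q)// ?nnegrE ?(ltW w0) ?(ltW (groot_gt0 z0))// grootX//.
  rewrite /V -/(Fpoly R r q) Fpoly_prod// horner_prod.
  case: (q) q_gt0 => // n' _; rewrite big_ord_recl /=.
  rewrite hornerD hornerX hornerC addr0 ler_peMr ?exprn_ge0 ?(ltW w0)//.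
  elim/big_ind : _ => // [x y|i _]; first exact: mulr_ege1.
  by rewrite hornerD hornerX hornerC -[leLHS]add0r lerD ?exprn_ge0 ?(ltW w0)// ler1n.
have Wj (j : nat) : (j < q.-1)%N -> W (w ^+ q) (groot (w ^+ q)) j.+1 <= n^-1.
  move=> jq; rewrite /W ler_pdivrMr ?exprn_gt0 ?groot_gt0//.
  have Vj : V (w ^+ q) j.+1 <= w ^+ q * M.
    rewrite VE big_ord_recl /= c0 addr0 ler_pM2l//.
    apply: (@le_trans _ _ (\prod_(m < j.+1) f m)).
      rewrite big_ord_recl /f /= c0 addr0 mul1r; apply: ler_prod => i _.
      by rewrite addr_ge0 ?(ltW z0)//= lerD2r ltW.
    have jq' : (j.+1 <= q)%N by rewrite -(prednK q_gt0) ltnS ltnW.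
    rewrite /M -(subnKC jq') big_split_ord /= ler_peMr//; last exact: prod_ge1.
    by apply: le_trans ler01 _; exact: (prod_ge1 0).
  apply: le_trans Vj _.
  have -> : w ^+ q * M = n^-1 * w ^+ q.-1.
    rewrite -{1}(prednK q_gt0) exprS {1}/w invfM; field.
    by rewrite !gt_eqF.
  rewrite ler_pM2l ?invr_gt0//.
  apply: (@le_trans _ _ (w ^+ j.+1)); last first.
    by apply: lerXn2r => //; rewrite nnegrE ltW// groot_gt0.
  by rewrite ler_wiXn2l ?(ltW w0) ?(ltW w1).
apply: (@le_lt_trans _ _ (\sum_(j < q.-1) n^-1)); first by apply: ler_sum => j _; exact: Wj.
rewrite sumr_const card_ord -[_ *+ _]mulr_natl ltr_pdivrMr// mul1r ltr_nat.
by rewrite ltnS leq_pred.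
Qed.

Let alt_sum_gt0 z : 0 < z -> \sum_(j < q.-1) W z (groot z) j.+1 < 1 -> 0 < alt_sum z.
Proof.
move=> z0 h; rewrite alt_sumE.
have -> : \sum_(i < q) (-1) ^+ i * W z (groot z) i =
    1 + \sum_(i < q.-1) (-1) ^+ i.+1 * W z (groot z) i.+1.
  case: (q) q_gt0 => // n _; rewrite big_ord_recl /= /W VE big_ord0 !expr0 mul1r divr1.
  by congr (_ + _).
rewrite -ltrBlDl sub0r ltrNl; apply: le_lt_trans h.
rewrite -sumrN; apply: ler_sum => j _.
have := W_gt0 j.+1 z0 (groot_gt0 z0); rewrite -signr_odd.
by case: odd; rewrite ?expr1 ?expr0; lra.
Qed.

Let alt_sum_continuous : {for 1, continuous alt_sum}.
Proof.
have cpoly (p : {poly R}) : {for 1, continuous (horner p)} by exact: continuous_horner.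
have F1 : 0 < (Fpoly R r q).[1] := V_gt0 q ltr01.
apply: cvg_big => [|i _]; first exact: add_continuous.
apply: cvgM; first exact: cvg_cst.
apply: cvgM; first exact: cpoly.
apply: cvgV; first by rewrite gt_eqF// powR_gt0.
apply: (@continuous_comp _ _ _ (horner (Fpoly R r q)) (@powR R ^~ (i%:R / q%:R))).
  exact: cpoly.
by apply/differentiable_continuous/derivable1_diffP/derivable_powR; rewrite in_itv/= F1.
Qed.

Lemma Dpoly_sign_changing_zero h : q = (2 * h.+1)%N -> coprime r q -> alt_sum 1 < 0 ->
  exists2 z, 0 < z < 1 & sign_changing_zero (Dpoly R r q) z.
Proof.
move=> qE crq B1.
have [z1 /andP[z10 z11] W1] := W_small crq.
have D_alt z := @Dpoly_alt_sum h z qE.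
have kappa0 := det_hankel_delta_real_neq0 R q_gt0.
move: (\det (hankel q (periodic_delta R q))) kappa0 D_alt => kappa kappa0 D_alt.
have [P1 [_ /(_ W1) P10 D1]] := D_alt z1 z10.
have B0 := alt_sum_gt0 z10 W1.
have D0 : Dpoly R r q != 0.
  apply/eqP => D0; move/eqP: D1; rewrite D0 horner0 eq_sym.
  by apply/negP; rewrite !mulf_neq0// gt_eqF.
(* D itself may vanish at 1. Splitting off its multiplicity there shows that it is nonzero just to
   the left of 1, where [alt_sum] is still negative. *)
have [m [g]] := multiplicity_XsubC (Dpoly R r q) 1; rewrite D0 /= => g1 DE.
have [e e0 he] := poly_sign_near g1.
have [d d0 hd] : exists2 d, 0 < d & forall z, 1 - d < z < 1 + d -> alt_sum z < 0.
  have nB0 : 0 < - alt_sum 1 by rewrite oppr_gt0.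
  move/cvgrPdist_lt : alt_sum_continuous => /(_ _ nB0) /nbhs_ballP[d /= d0 hd].
  exists d => // z /andP[za zb].
  have : `|alt_sum 1 - alt_sum z| < - alt_sum 1.
    by apply: hd; rewrite /ball/= ltr_norml; apply/andP; split; lra.
  by rewrite ltr_norml => /andP[]; lra.
(* Half of s moves z2 strictly inside both neighbourhoods of 1 and keeps it to the right of z1. *)
pose s := Num.min (Num.min e d) (1 - z1).
have s0 : 0 < s by rewrite !lt_min e0 d0 subr_gt0.
have [se [sd sz]] : s <= e /\ s <= d /\ s <= 1 - z1.
  by rewrite !ge_min !lexx !orbT.
pose z2 := 1 - s / 2.
have z20 : 0 < z2 by rewrite /z2; lra.
have [P2 [P20 _ D2]] := D_alt z2 z20.
have B2 : alt_sum z2 < 0 by apply: hd; rewrite /z2; lra.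
have D2n0 : (Dpoly R r q).[z2] != 0.
  rewrite DE hornerM horner_exp hornerXsubC mulf_neq0//; last first.
    by rewrite expf_neq0// /z2; apply/eqP; lra.
  have : 0 < g.[z2] * g.[1] by apply: he; rewrite /z2; lra.
  by apply: contraTneq => ->; rewrite mul0r ltxx.
have P2gt0 : 0 < P2.
  by rewrite lt_def P20 andbT; apply: contraNneq D2n0 => P2z; rewrite D2 P2z mulr0 mul0r.
have D12 : (Dpoly R r q).[z1] * (Dpoly R r q).[z2] < 0.
  have -> : (Dpoly R r q).[z1] * (Dpoly R r q).[z2] =
      kappa ^+ 2 * (P1 * P2 * alt_sum z1) * alt_sum z2 by rewrite D1 D2; ring.
  rewrite pmulr_rlt0// mulr_gt0 ?exprn_even_gt0//.
  by rewrite mulr_gt0// mulr_gt0.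
have z12 : z1 < z2 by rewrite /z2; lra.
have [z /andP[zz1 zz2] hz] := sign_changing_zero_between z12 D12.
exists z => //; apply/andP; split; first exact: lt_trans zz1.
by apply: lt_trans zz2 _; rewrite /z2; lra.
Qed.
End DpolySign.

Lemma Bhat_limit_lt0 (R : realType) : expR 1 / (expR 1 + 1) * (1 - Ahat R) < 0.
Proof. by rewrite pmulr_rlt0 ?subr_lt0 ?Ahat_gt1// divr_gt0 ?addr_gt0 ?expR_gt0. Qed.

Theorem theorem7 (R : realType) :
  [/\ \forall n \near \oo, Bhat R n < 0,
      \forall n \near \oo, exists2 z : R,
        0 < z < 1 & sign_changing_zero (Dpoly R 3 (qhat n)) z,
      Bhat R n @[n --> \oo] --> expR 1 / (expR 1 + 1) * (1 - Ahat R),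
      expR 1 / (expR 1 + 1) * (1 - Ahat R) < 0
    & 1 < Ahat R].
Proof.
have L0 := Bhat_limit_lt0 R.
have B0 : \forall n \near \oo, Bhat R n < 0 by exact: cvgr_lt (@Bhat_cvg R) _ L0.
split=> //; [|exact: Bhat_cvg|exact: Ahat_gt1].
have n0 : \forall n \near \oo, (0 < n)%N by exact: nbhs_infty_gt.
near=> n; have [m nE] : exists m, n = m.+1.
  by exists n.-1; rewrite prednK//; near: n.
have /andP[c3 q3] : coprime 3 (qhat n) && (3 < qhat n)%N by apply: coprime_qhat; rewrite nE.
(* For n = m + 1, q = 6m + 4 = 2 (3m + 2), so h = 3m + 1. *)
apply: (@Dpoly_sign_changing_zero R 3 (qhat n) _ (3 * m).+1) => //.
- exact: ltn_trans q3.
- by rewrite nE qhatS; lia.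
- by near: n.
Unshelve. all: by end_near.
Qed.
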